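(* Let $h,k,\ell\in\mathbb{N}$ be fixed and let $\theta_k\in(0,1]$ be an exponent of distribution for $d_k(n)$. Then $$\liminf_{x\rightarrow\infty}\frac{\sum_{n\leq x}d_k(n+h)d_{\ell}(n)}{x\log^{k+\ell-2}x}\geq \theta_k^{\ell-1}\,\frac{C_{k,\ell}f_{k,\ell}(h)}{(k-1)!(\ell-1)!}.$$
   Context: $\mathbb{N}$ denotes the positive integers, and $(m,n)$ denotes the greatest common divisor. $d_k(n)$ is the number of ways of writing $n$ as an ordered product of $k$ positive integer factors (so $d_1(n)=1$, and $d_0(n)=1$ if $n=1$ and $0$ otherwise). The constants are $$C_{k,\ell}=\prod_p\left( \left(1-p^{-1}\right)^{\ell-1}+\left(1-p^{-1}\right)^{k-1}-\left(1-p^{-1}\right)^{k+\ell-2}\right)$$ (product over all primes) and, writing $h=\prod_p p^{\gamma}$ with $\gamma=\gamma(p)$ the exponent of $p$ in $h$, $$f_{k,\ell}(h)=\prod_{p\mid h} \frac{(1-p^{-1})\sum_{\alpha=0}^{\gamma}d_{\ell-1}(p^{\alpha})\sum_{\beta=\alpha}^{\infty}d_k(p^{\beta})p^{-\beta}+d_k(p^{\gamma})\sum_{\alpha=\gamma+1}^{\infty}d_{\ell-1}(p^{\alpha}) p^{-\alpha}}{(1-p^{-1})^{1-k}+(1-p^{-1})^{1-\ell}-1}.$$ Exponent of distribution: for $g\in\mathbb{N}$, a real number $0<\theta_{g,k}\leq 1$ is an exponent of distribution for $d_k(n)$ (with respect to $g$) if for every fixed $\epsilon>0$ there is a fixed $\delta>0$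 such that for every $q\leq x^{\theta_{g,k}-\epsilon}$ and each residue class $h\not\equiv 0\pmod q$ with $(h,q)=g$, $$\sum_{\substack{n\leq x\\ n\equiv h \pmod q}} d_k(n)= \frac{1}{\phi(q/g)}\,\mathrm{Res}\left(\frac{x^{s}}{s}\sum_{(n,q)=g}\frac{d_k(n)}{n^s},\ s=1\right)+O_{\epsilon,\delta,k}\left(\frac{x^{1-\delta}}{\phi(q/g)}\right),$$ where $\phi$ is Euler's function and the Dirichlet series is meromorphically continued to a neighbourhood of $s=1$. Convention: $\theta_k$ denotes a single number that is an exponent of distribution for $d_k(n)$ for all $g$ simultaneously, i.e. one may take $\theta_{g,k}=\theta_k$ for every $g$. *)

(* Defs.v *)
From HB Require Import structures.
From mathcomp Require Import all_boot all_order all_algebra.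
From mathcomp Require Import complex.
From mathcomp Require Import all_classical all_reals all_analysis.
Set Implicit Arguments.
Unset Strict Implicit.
Unset Printing Implicit Defensive.
Import Order.TTheory GRing.Theory Num.Theory.
Import numFieldNormedType.Exports.
Local Open Scope classical_set_scope.
Local Open Scope ring_scope.

(* d_k(n).  For n > 0 every factor of a factorization of n lies in [1, n], so
   counting in 'I_n.+1 loses nothing; the value at n = 0 is never used. *)
Definition divk (k n : nat) : nat :=
  #|[pred t : {ffun 'I_k -> 'I_n.+1} | (\prod_(i < k) t i)%N == n]|.

Definition Ckl (R : realType) (k l : nat) : R :=
  \big[*%R/1]_(0 <= p <oo | prime p)
    ((1 - p%:R^-1) ^+ (l - 1) + (1 - p%:R^-1) ^+ (k - 1)
     - (1 - p%:R^-1) ^+ (k + l - 2) : R).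

Definition fkl (R : realType) (k l h : nat) : R :=
  \prod_(p <- primes h)
    let gamma := logn p h in
    ((1 - p%:R^-1) *
       (\sum_(0 <= a < gamma.+1) (divk (l - 1) (p ^ a))%:R *
          \big[+%R/0]_(a <= b <oo) ((divk k (p ^ b))%:R * p%:R ^- b : R))
     + (divk k (p ^ gamma))%:R *
          \big[+%R/0]_(gamma.+1 <= a <oo) ((divk (l - 1) (p ^ a))%:R * p%:R ^- a : R))
    / ((1 - p%:R^-1) ^- (k - 1) + (1 - p%:R^-1) ^- (l - 1) - 1).

(* x ^ s = exp (s log x) for real x > 0 and complex s = sigma + i t. *)
Definition cpow (R : realType) (x : R) (s : R[i]) : R[i] :=
  Complex (expR (complex.Re s * ln x) * cos (complex.Im s * ln x))
          (expR (complex.Re s * ln x) * sin (complex.Im s * ln x)).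

(* Derivability over the field R[i] is complex differentiability. *)
Definition holomorphic_at (R : realType) (F : R[i] -> R[i]) (s0 : R[i]) : Prop :=
  \forall s \near (s0 : R[i]^o), derivable (F : R[i]^o -> R[i]^o) s 1.

Definition meromorphic_at (R : realType) (F : R[i] -> R[i]) (s0 : R[i]) : Prop :=
  exists (m : nat) (G : R[i] -> R[i]), holomorphic_at G s0 /\
    \forall s \near (s0 : R[i]^o)^', F s = G s / (s - s0) ^+ m.

(* r is the coefficient of (s - s0)^-1 in the Laurent expansion of F, which has
   at most a pole at s0. *)
Definition is_residue (R : realType) (F : R[i] -> R[i]) (s0 r : R[i]) : Prop :=
  exists (m : nat) (a : nat -> R[i]) (G : R[i] -> R[i]),
    [/\ holomorphic_at G s0,
        \forall s \near (s0 : R[i]^o)^',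
          F s = G s + \sum_(j < m.+1) a j / (s - s0) ^+ j.+1
      & r = a 0%N].

(* D is, near s = 1, the meromorphic continuation of the Dirichlet series
   \sum_{(n, q) = g} d_k(n) n^-s, which converges for Re s > 1. *)
Definition is_dirichlet_continuation (R : realType) (k q g : nat)
    (D : R[i] -> R[i]) : Prop :=
  meromorphic_at D 1 /\
  \forall s \near (1 : R[i]^o), 1 < complex.Re s ->
    (fun N : nat => \sum_(1 <= n < N | gcdn n q == g)
                      (divk k n)%:R / cpow (n%:R : R) s : R[i]^o) @ \oo --> (D s : R[i]^o).

(* theta is an exponent of distribution for d_k with respect to g.  In the
   bound, residue classes are represented by natural numbers a.  The existential
   D and r only name the continuation (unique near 1) and its residue. *)
Definition exponent_of_distribution (R : realType) (k g : nat) (theta : R) : Prop :=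
  forall eps : R, 0 < eps -> exists2 delta : R, 0 < delta & exists K : R,
  forall (x : R) (q a : nat), 1 <= x -> (0 < q)%N ->
    q%:R <= x `^ (theta - eps) -> ~~ (q %| a)%N -> gcdn a q = g ->
  exists (D : R[i] -> R[i]) (r : R[i]),
    [/\ is_dirichlet_continuation k q g D,
        is_residue (fun s => cpow x s / s * D s) 1 r
      & `| (\sum_(1 <= n < (Num.truncn x).+1 | n == a %[mod q]) divk k n)%N%:R
           - r / (totient (q %/ g))%:R |
        <= (K * (x `^ (1 - delta) / (totient (q %/ g))%:R))%:C%C].

(* Main.v *)
(* Write d_l = 1 * d_{l-1} and keep only the divisors q <= x^(theta - eps): the
   sum is at least
     sum_(q <= x^(theta-eps)) d_{l-1}(q) sum_(n <= x, n = h mod q) d_k(n) + o(x).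
   The main term of the exponent of distribution is the same for all classes a
   with gcd(a, q) = gcd(h, q) = g; averaging over these classes identifies it with
   (1/phi(q/g)) sum_(n <= x, gcd(n, q) = g) d_k(n), so the Dirichlet series itself
   never has to be continued.  There remains the double sum of
   d_k(n) d_{l-1}(q) / phi(q/g) over the pairs with gcd(n, q) = gcd(h, q).  For
   Q = z! write n = a n', q = b q' with a, b composed of primes <= z and n', q'
   coprime to Q.  Up to an error O(z^(-1/2)), coming from pairs with a common prime
   factor > z, the gcd condition concerns (a, b) only; the sums over n' and q' have
   elementary asymptotic lower bounds, and the sum over (a, b) factors into an
   Euler product over p <= z, which dominates C_{k,l} f_{k,l}(h) because the factors
   of C_{k,l} lie in [0, 1]. *)
Require Import Defs.
From mathcomp Require Import all_boot all_order all_algebra complex.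
From mathcomp Require Import all_classical all_reals all_analysis.
From mathcomp Require Import zify ring lra.
Set Implicit Arguments.
Unset Strict Implicit.
Unset Printing Implicit Defensive.
Import Order.TTheory GRing.Theory Num.Theory.
Import numFieldNormedType.Exports.
Local Open Scope classical_set_scope.
Local Open Scope ring_scope.

(** * Uniqueness of residues *)

(** Since only a lower bound is at stake, the sums over smooth numbers and over prime exponents are
    cut off at finite [M] and [N]: nonnegativity makes each cut harmless, and upper bounds are
    needed for error terms only. The obstacle is that the bound for pairs sharing a prime above [z]
    has the same order [x log^(k+l-2) x] as the main term, so its constant must vanish as [z] grows.
    Two divisibilities by [p] save [sum_(p > z) p^-2 <= 1 / z], but the elementary estimates need
    [1 / q] instead of the totient weight, and this exchange costs [h] divided by the density of
    integers coprime to [z!]. For odd [z] that density is at least [1 / (2 sqrt z)], hence the net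
    exponent -1/2. The power [theta^(l-1)] comes from summing [d_(l-1)(q) / q] up to
    [x^(theta - eps)]. The parameters are fixed in the order [eps], [z], [M], and [x] goes to
    infinity last: [Q] and [M] then enter only as constants added to logarithms and drop out of the
    limit. *)

Lemma cvg_sumr (K : numFieldType) (V : normedModType K) (T I : Type) (F : set_system T)
    (FF : Filter F) (r : seq I) (f : I -> T -> V) (a : I -> V) :
  (forall i, f i @ F --> a i) ->
  (fun t => \sum_(i <- r) f i t) @ F --> \sum_(i <- r) a i.
Proof.
move=> fa; elim: r => [|i r IH].
  by under eq_fun do rewrite big_nil; rewrite big_nil; apply: cvg_cst.
under eq_fun do rewrite big_cons; rewrite big_cons; exact: cvgD.
Qed.

Lemma cvg_prodr (K : numFieldType) (T I : Type) (F : set_system T) (FF : Filter F)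
    (r : seq I) (f : I -> T -> K^o) (a : I -> K^o) :
  (forall i, f i @ F --> a i) ->
  (fun t => \prod_(i <- r) f i t : K^o) @ F --> (\prod_(i <- r) a i : K^o).
Proof.
move=> fa; elim: r => [|i r IH].
  by under eq_fun do rewrite big_nil; rewrite big_nil; apply: cvg_cst.
by under eq_fun do rewrite big_cons; rewrite big_cons; exact: cvgM.
Qed.

Lemma cvg_exprn (K : numFieldType) (T : Type) (F : set_system T) (FF : Filter F)
    (n : nat) (f : T -> K^o) (a : K^o) :
  f @ F --> a -> (fun t => f t ^+ n : K^o) @ F --> (a ^+ n : K^o).
Proof.
move=> fa; elim: n => [|n IH].
  by under eq_fun do rewrite expr0; rewrite expr0; apply: cvg_cst.
by under eq_fun do rewrite exprS; rewrite exprS; exact: cvgM.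
Qed.

Section Residue.
Variable C : numFieldType.
Implicit Types (e H : nat -> C^o) (c : nat -> C).

(** After multiplication by the highest power of [e n], every term except the top coefficient tends
    to 0. So that coefficient is 0, and the induction strips it off. *)
Lemma laurent_coef0 (M : nat) c e H (L : C^o) :
  e @ \oo --> (0 : C^o) -> (forall n, e n != 0) -> H @ \oo --> L ->
  (\forall n \near \oo, H n + \sum_(j < M) c j / e n ^+ j.+1 = 0) ->
  forall j, (j < M)%N -> c j = 0.
Proof.
move=> e0 ne0 HL; elim: M => // M IH near0.
have cM : c M = 0.
  have lim1 : (fun n => - (H n * e n ^+ M.+1 + \sum_(j < M) c j * e n ^+ (M - j)) : C^o)
      @ \oo --> (0 : C^o).
    rewrite -[X in _ --> X]oppr0; apply: cvgN.
    rewrite -[X in _ --> X]addr0; apply: cvgD.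
      by have := cvgM HL (@cvg_exprn _ _ _ _ M.+1 _ _ e0); rewrite expr0n mulr0 => h; exact: h.
    have := @cvg_sumr C (C^o) nat 'I_M \oo _ (index_enum 'I_M)
      (fun (j : 'I_M) n => c j * e n ^+ (M - j)) (fun=> 0).
    rewrite big1 //; apply => j.
    have := cvgM (cvg_cst (c j : C^o)) (@cvg_exprn _ _ _ _ (M - j)%N _ _ e0).
    by rewrite expr0n subn_eq0 leqNgt ltn_ord mulr0 => h; exact: h.
  have lim2 : (fun n => - (H n * e n ^+ M.+1 + \sum_(j < M) c j * e n ^+ (M - j)) : C^o)
      @ \oo --> (c M : C^o).
    apply: cvg_near_cst; near=> n.
    have /eqP : H n + \sum_(j < M.+1) c j / e n ^+ j.+1 = 0 by near: n.
    rewrite big_ord_recr /= addrA addr_eq0 => /eqP eqn.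
    have -> : c M = - (- (c M / e n ^+ M.+1)) * e n ^+ M.+1.
      by rewrite opprK divfK // expf_neq0.
    rewrite -eqn mulNr mulrDl mulr_suml; congr (- (_ + _)).
    apply: eq_bigr => j _; rewrite -mulrA; congr (_ * _).
    have -> : M.+1 = (M - j + j.+1)%N by have := ltn_ord j; lia.
    by rewrite exprD mulrCA mulVf ?mulr1 // expf_neq0.
  exact: norm_cvg_unique lim2 lim1.
move=> j; rewrite ltnS leq_eqVlt => /orP[/eqP -> //|]; apply: IH.
near=> n; rewrite -[RHS](near near0 n) //; congr (_ + _).
by rewrite big_ord_recr /= cM mul0r addr0.
Unshelve. all: by end_near. Qed.

End Residue.

Section ResidueC.
Variable R : realType.

(* Only values with 1 < Re s are compared, so no analytic continuation is needed. *)
Lemma is_residue_unique (F1 F2 : R[i] -> R[i]) (r1 r2 : R[i]) :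
  (\forall s \near (1 : R[i]^o), 1 < complex.Re s -> F1 s = F2 s) ->
  is_residue F1 1 r1 -> is_residue F2 1 r2 -> r1 = r2.
Proof.
move=> F12 [m1 [a1 [G1 [hG1 FG1 ->]]]] [m2 [a2 [G2 [hG2 FG2 ->]]]].
(* The point 1 is approached from the right along the real axis, inside the half-plane where [F1]
   and [F2] agree. *)
pose e (n : nat) : R[i]^o := (n.+1%:R^-1)%:C%C.
have e0 : e @ \oo --> (0 : R[i]^o).
  apply/cvgrPdist_lt => d d0.
  have [d' d'0 dd'] : exists2 d' : R, 0 < d' & d'%:C%C = d.
    case: d d0 => x y; rewrite ltcE /= => /andP[/eqP -> x0].
    by exists x.
  have H : \forall n \near \oo, n.+1%:R^-1 < d'.
    have := cvgr0_norm_lt (@harmonic R) (@cvg_harmonic R) _ d'0.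
    case=> N _ hN; exists N => // n /hN /=; rewrite /harmonic ger0_norm ?invr_ge0 //.
  near=> n; rewrite sub0r normrN -dd'.
  rewrite ger0_norm ?lecR ?invr_ge0 // ltcR.
  by near: n.
have ne0 n : e n != 0 by rewrite /e -(rmorph0 (real_complex R)) (inj_eq (@complexI _)) invr_eq0 pnatr_eq0.
pose s (n : nat) : R[i]^o := 1 + e n.
have s1 : s @ \oo --> (1 : R[i]^o).
  by have := cvgD (cvg_cst (1 : R[i]^o)) e0; rewrite addr0; apply.
have holo_cvg G : holomorphic_at G (1 : R[i]) -> (fun n => G (s n) : R[i]^o) @ \oo --> (G 1 : R[i]^o).
  move=> /nbhs_singleton /derivable1_diffP /differentiable_continuous Gc.
  exact: (cvg_comp _ _ s1 Gc).
have sd : s @ \oo --> (1 : R[i]^o)^'.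
  move=> A; rewrite /dnbhs/= => /s1; rewrite !/(nbhs _) /=.
  apply: filterS => n; apply; rewrite /s -subr_eq0 addrAC subrr add0r; exact: ne0.
pose M := maxn m1.+1 m2.+1.
pose c j := (if (j < m1.+1)%N then a1 j else 0) - (if (j < m2.+1)%N then a2 j else 0).
have : c 0%N = 0.
  have GB : (fun n => G1 (s n) - G2 (s n) : R[i]^o) @ \oo --> (G1 1 - G2 1 : R[i]^o).
    exact: cvgB (holo_cvg _ hG1) (holo_cvg _ hG2).
  have Lc := laurent_coef0 (c := c) (M := M) e0 ne0 GB.
  apply: Lc; last by rewrite /M leq_max.
    near=> n.
    have E1 : F1 (s n) = G1 (s n) + \sum_(j < m1.+1) a1 j / (s n - 1) ^+ j.+1.
      by near: n; exact: sd FG1.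
    have E2 : F2 (s n) = G2 (s n) + \sum_(j < m2.+1) a2 j / (s n - 1) ^+ j.+1.
      by near: n; exact: sd FG2.
    have E3 : F1 (s n) = F2 (s n).
      have : 1 < complex.Re (s n) -> F1 (s n) = F2 (s n) by near: n; exact: s1 F12.
      by apply; rewrite /s raddfD /= ltrDl invr_gt0.
    have se : s n - 1 = e n by rewrite /s addrAC subrr add0r.
    rewrite se in E1 E2.
    have W m (a : nat -> R[i]) : (m <= M)%N ->
       \sum_(j < M) (if (j < m)%N then a j else 0) / e n ^+ j.+1 =
       \sum_(j < m) a j / e n ^+ j.+1.
      move=> mM; rewrite (big_ord_widen M (fun j => a j / e n ^+ j.+1)) // [RHS]big_mkcond /=.
      by apply: eq_bigr => j _; case: ifP; rewrite ?mul0r.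
    under eq_bigr do rewrite mulrBl.
    rewrite sumrB !W ?leq_maxl ?leq_maxr //.
    by rewrite addrACA -opprD -E1 -E2 E3 subrr.
by rewrite /c /= => /eqP; rewrite subr_eq0 => /eqP.
Unshelve. all: by end_near. Qed.

End ResidueC.

(** * Divisor functions *)

Section Divk.
Implicit Types k n B : nat.

(** Splitting off the first factor relates [n] to its divisors inside one common box, whereas [divk]
    uses a box depending on its argument. Hence the recursion is first proved for a fixed box
    ([cntS]), independence of the box follows from it by induction ([cntE]), and only then is the
    recursion transferred to [divk]. *)
Lemma divk_widen k n B : (0 < n)%N -> (n <= B)%N ->
  (\sum_(t : {ffun 'I_k -> 'I_B.+1}) (\prod_(i < k) t i == n)%N = divk k n)%N /\
  divk k.+1 n = (\sum_(d <- divisors n) divk k d)%N.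
Proof.
pose cnt k B n := (\sum_(t : {ffun 'I_k -> 'I_B.+1}) (\prod_(i < k) t i == n))%N.
have divkE j i : divk j i = cnt j i i by rewrite /divk -sum1_card big_mkcond.
have cntS j C i : (0 < i)%N -> (i <= C)%N ->
    cnt j.+1 C i = (\sum_(d <- divisors i) cnt j C d)%N.
  move=> i0 iC.
  pose f (u : 'I_C.+1 * {ffun 'I_j -> 'I_C.+1}) : {ffun 'I_j.+1 -> 'I_C.+1} :=
    [ffun x => oapp u.2 u.1 (unlift ord0 x)].
  pose g (t : {ffun 'I_j.+1 -> 'I_C.+1}) := (t ord0, [ffun x => t (lift ord0 x)]).
  rewrite /cnt (reindex f) /=; last first.
    exists g => [[x t] _|t _].
      by rewrite /g /f ffunE unlift_none; congr (_, _); apply/ffunP => y; rewrite !ffunE liftK.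
    apply/ffunP => y; rewrite !ffunE; case: unliftP => [z ->|->] //=; by rewrite ffunE.
  rewrite -(pair_bigA _ (fun x t => ((\prod_(y < j.+1) f (x, t) y)%N == i) : nat)) /=.
  rewrite [RHS]exchange_big [LHS]exchange_big /=; apply: eq_bigr => t _.
  under eq_bigr => x _.
    rewrite big_ord_recl ffunE unlift_none /=.
    under eq_bigr => y _ do rewrite ffunE liftK /=.
    over.
  set P := (\prod_(y < j) _)%N.
  have -> : (\sum_(d <- divisors i) (P == d) = (P \in divisors i))%N.
    by rewrite -big_mkcond /= sum1_count -(@eq_count _ (pred1 P)) ?count_uniq_mem ?divisors_uniq.
  rewrite -dvdn_divisors //; case: (boolP (P %| i)%N) => [/dvdnP[c Ec]|nP].
    have P0 : (0 < P)%N by move: i0; rewrite Ec muln_gt0 => /andP[].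
    have cC : (c < C.+1)%N by rewrite ltnS; apply: leq_trans iC; rewrite Ec leq_pmulr.
    rewrite (bigD1 (Ordinal cC)) //= -Ec eqxx big1 // => x xc.
    apply/eqP; rewrite eqb0 Ec eqn_pmul2r //.
  rewrite big1 // => x _; apply/eqP; rewrite eqb0.
  by apply: contra nP => /eqP <-; rewrite dvdn_mull.
have cntE j i C : (0 < i)%N -> (i <= C)%N -> cnt j C i = cnt j i i.
  elim: j i C => [|j IH] i C i0 iC.
    have c0 D : cnt 0%N D i = (1%N == i).
      rewrite /cnt (eq_bigr (fun=> ((1%N == i) : nat))); last by move=> t _; rewrite big_ord0.
      by rewrite sum_nat_const card_ffun !card_ord expn0 mul1n.
    by rewrite !c0.
  rewrite !cntS // big_seq [RHS]big_seq; apply: eq_bigr => d.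
  rewrite -dvdn_divisors // => di.
  have d0 := dvdn_gt0 i0 di; have dle := dvdn_leq i0 di.
  by rewrite (IH d C) ?(IH d i) // (leq_trans dle).
move=> n0 nB; split; first by rewrite divkE -(cntE _ _ B).
rewrite divkE cntS // big_seq [RHS]big_seq; apply: eq_bigr => d.
rewrite -dvdn_divisors // => dn; rewrite divkE cntE ?(dvdn_gt0 n0 dn) //.
exact: dvdn_leq.
Qed.

Lemma divkS k n : (0 < n)%N -> divk k.+1 n = (\sum_(d <- divisors n) divk k d)%N.
Proof. by move=> n0; have [] := @divk_widen k n n n0 (leqnn n). Qed.

Lemma divk0 n : divk 0 n = (n == 1%N).
Proof.
rewrite /divk -sum1_card big_mkcond /=.
rewrite (eq_bigr (fun=> ((1 == n)%N : nat))); last by move=> t _; rewrite unfold_in /= big_ord0; case: eqP.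
by rewrite sum_nat_const card_ffun !card_ord expn0 mul1n eq_sym.
Qed.

Lemma divk_1 k : divk k 1 = 1%N.
Proof.
elim: k => [|k IH]; first by rewrite divk0.
by rewrite divkS // (_ : divisors 1 = [:: 1%N]) // big_seq1.
Qed.

Lemma divisors_coprime_mul m n : (0 < m)%N -> (0 < n)%N -> coprime m n ->
  perm_eq (divisors (m * n)) [seq (a * b)%N | a <- divisors m, b <- divisors n].
Proof.
move=> m0 n0 mn; apply: uniq_perm; first exact: divisors_uniq.
- apply: allpairs_uniq; rewrite ?divisors_uniq // => -[a b] [c d].
  move=> /allpairsP[[a1 b1] /= [a1m b1n [-> ->]]] /allpairsP[[c1 d1] /= [c1m d1n [-> ->]]] /= E.
  move: a1m b1n c1m d1n; rewrite -!dvdn_divisors // => am bn cm dn.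
  have cop x y : (x %| m)%N -> (y %| n)%N -> coprime x y.
    by move=> xm yn; apply: coprime_dvdl xm _; apply: coprime_dvdr yn _.
  have dv x y z t : (x %| m)%N -> (y %| n)%N -> (z %| m)%N -> (t %| n)%N ->
      (x * y = z * t)%N -> (x %| z)%N.
    by move=> xm yn zm tn e; rewrite -(Gauss_dvdl z (cop _ _ xm tn)) -e dvdn_mulr.
  have ac : a1 = c1.
    by apply/eqP; rewrite eqn_dvd (dv a1 b1 c1 d1) ?(dv c1 d1 a1 b1).
  congr (_, _) => //; apply/eqP; rewrite -(eqn_pmul2l (dvdn_gt0 m0 am)) E ac //.
- move=> d; rewrite -dvdn_divisors ?muln_gt0 ?m0 //.
  apply/idP/allpairsP => [dmn|[[a b] /= [am bn ->]]]; last first.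
    by move: am bn; rewrite -!dvdn_divisors // => am bn; rewrite dvdn_mul.
  exists (gcdn d m, gcdn d n); rewrite /= -!dvdn_divisors // !dvdn_gcdr; split => //.
  by apply/eqP; rewrite eqn_dvd; apply/andP; split;
   [by rewrite muln_gcdr dvdn_gcd dvdn_mull //= muln_gcdl dvdn_gcd dvdn_mulr
   |rewrite Gauss_dvd ?dvdn_gcdl // (coprime_dvdl (dvdn_gcdr _ _)) // (coprime_dvdr (dvdn_gcdr _ _))].
Qed.

Lemma divkM k m n : (0 < m)%N -> (0 < n)%N -> coprime m n ->
  divk k (m * n) = (divk k m * divk k n)%N.
Proof.
elim: k m n => [|k IH] m n m0 n0 mn.
  by rewrite !divk0 muln_eq1; do 2!case: eqP.
rewrite !divkS ?muln_gt0 ?m0 // (perm_big _ (divisors_coprime_mul m0 n0 mn)) /=.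
rewrite big_allpairs_dep big_distrl /= big_seq [RHS]big_seq; apply: eq_bigr => a.
rewrite -dvdn_divisors // => am; rewrite big_distrr /= big_seq [RHS]big_seq.
apply: eq_bigr => b; rewrite -dvdn_divisors // => bn.
rewrite IH ?(dvdn_gt0 _ am) ?(dvdn_gt0 _ bn) //.
by apply: coprime_dvdl am _; apply: coprime_dvdr bn _.
Qed.

Lemma divk_prime_powS k p b : prime p ->
  divk k.+1 (p ^ b.+1) = (divk k.+1 (p ^ b) + divk k (p ^ b.+1))%N.
Proof.
move=> pp; have pos j : (0 < p ^ j)%N by rewrite expn_gt0 prime_gt0.
have E j : perm_eq (divisors (p ^ j)) [seq (p ^ i)%N | i <- iota 0 j.+1].
  apply: uniq_perm; first exact: divisors_uniq.
    rewrite map_inj_uniq ?iota_uniq // => x y; apply: expnI; exact: prime_gt1.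
  move=> d; rewrite -dvdn_divisors //; apply/idP/mapP.
    by move=> /(dvdn_pfactor _ _ pp)[i ij ->]; exists i; rewrite // mem_iota.
  by case=> i; rewrite mem_iota => ij ->; apply/(dvdn_pfactor _ _ pp); exists i.
rewrite !divkS // !(perm_big _ (E _)) !big_map.
by rewrite -[iota 0 b.+2]/(index_iota 0 b.+2) -[iota 0 b.+1]/(index_iota 0 b.+1) big_nat_recr.
Qed.

End Divk.

(** * Summation over a Dirichlet convolution with the constant function 1 *)

Section SumConv.
Variable R : pzSemiRingType.

Lemma sum_multiples (b X : nat) (F : nat -> R) : (0 < b)%N ->
  \sum_(1 <= n < X.+1 | (b %| n)%N) F n =
  \sum_(1 <= a < (X %/ b).+1) F (a * b)%N.
Proof.
move=> b0; rewrite -big_filter -(big_map (fun a => a * b)%N predT F).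
apply: perm_big; apply: uniq_perm.
- by rewrite filter_uniq // iota_uniq.
- rewrite map_inj_uniq ?iota_uniq // => x y /eqP; by rewrite eqn_pmul2r // => /eqP.
move=> n; rewrite mem_filter mem_index_iota; apply/idP/mapP.
  move=> /andP[/dvdnP[a ->]] /andP[ab1]; rewrite ltnS => abX; exists a => //.
  rewrite mem_index_iota ltnS leq_divRL // abX andbT.
  by move: ab1; rewrite muln_gt0 => /andP[].
move=> [a]; rewrite mem_index_iota ltnS leq_divRL // => /andP[a1 aX] ->.
by rewrite dvdn_mull //= muln_gt0 a1 b0.
Qed.

(** The estimates of divisor sums below, from above and from below, all start here:
    [d_(k+1) = 1 * d_k], with the sum over the free factor [a] performed inside. *)
Lemma sum_divkS k X (F : nat -> R) :
  \sum_(1 <= n < X.+1) (divk k.+1 n)%:R * F n =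
  \sum_(1 <= b < X.+1) (divk k b)%:R * \sum_(1 <= a < (X %/ b).+1) F (a * b)%N.
Proof.
have E n : (1 <= n < X.+1)%N ->
    (divk k.+1 n)%:R * F n = \sum_(1 <= b < X.+1 | (b %| n)%N) (divk k b)%:R * F n.
  move=> /andP[n1 nX]; rewrite divkS // natr_sum mulr_suml -[RHS]big_filter.
  apply: perm_big; apply: uniq_perm.
  - exact: divisors_uniq.
  - by rewrite filter_uniq // iota_uniq.
  move=> d; rewrite -dvdn_divisors // mem_filter mem_index_iota.
  case: (boolP (d %| n)%N) => //= dn; rewrite (dvdn_gt0 n1 dn) /=.
  by symmetry; apply: leq_trans nX; rewrite ltnS dvdn_leq.
rewrite (eq_big_nat _ _ E) (exchange_big_dep predT) //=; apply: eq_big_nat => b /andP[b1 _].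
by rewrite -sum_multiples // mulr_sumr.
Qed.

End SumConv.

(** * Upper bounds for divisor sums *)

Section Upper.
Variable R : realType.
Implicit Types (k p X Y : nat).

Definition harm X : R := \sum_(1 <= a < X.+1) a%:R^-1.
Definition lsum k X : R := \sum_(1 <= q < X.+1) (divk k q)%:R * q%:R^-1.

Lemma harm_ge0 X : 0 <= harm X.
Proof. by apply: sumr_ge0 => i _; rewrite invr_ge0. Qed.

Lemma ler_sum_nat_widen (F : nat -> R) X Y : (X <= Y)%N -> (forall n, 0 <= F n) ->
  \sum_(1 <= q < X.+1) F q <= \sum_(1 <= q < Y.+1) F q.
Proof.
move=> XY F0; rewrite [leRHS](big_cat_nat _ (n := X.+1)) //= lerDl.
by apply: sumr_ge0 => i _.
Qed.

Lemma harm_le X Y : (X <= Y)%N -> harm X <= harm Y.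
Proof. by move=> XY; apply: ler_sum_nat_widen => // n; rewrite invr_ge0. Qed.

Lemma harm_le_ln X : (0 < X)%N -> harm X <= 1 + ln X%:R.
Proof.
elim: X => // -[_ _|X IH _].
  by rewrite /harm big_nat1 invr1 ln1 addr0.
rewrite /harm big_nat_recr //= -/(harm _).
apply: le_trans (lerD (IH isT) (lexx _)) _; rewrite -addrA lerD2l.
rewrite -lerBrDl -[leRHS]opprB lerNr.
have X0 (n : nat) : 0 < n.+1%:R :> R by [].
rewrite -ln_div ?posrE ?X0 //.
have -> : X.+1%:R / X.+2%:R = 1 + - X.+2%:R^-1 :> R.
  apply: (mulIf (lt0r_neq0 (X0 X.+1))); rewrite divfK ?lt0r_neq0 //.
  by rewrite mulrDl mulNr mulVf ?lt0r_neq0 // mul1r -[X.+2%:R]natr1 addrK.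
apply: le_ln1Dx; rewrite ltrN2 invf_lt1 ?X0 ?ltr1n //.
Qed.

(** The constraint that the product of the [k] factors is at most [X] is relaxed to each factor
    being at most [X]. *)
Lemma lsum_le k X : lsum k X <= harm X ^+ k.
Proof.
elim: k => [|k IH].
  case: X => [|X]; rewrite expr0 /lsum; first by rewrite big_geq.
  rewrite big_ltn // divk0 eqxx mul1r invr1 big1_seq ?addr0 // => i.
  by rewrite mem_index_iota divk0 => /andP[_ /andP[i1 _]]; rewrite gtn_eqF // mul0r.
rewrite /lsum sum_divkS exprSr; apply: le_trans (ler_wpM2r (harm_ge0 X) IH).
rewrite /lsum mulr_suml; apply: ler_sum_nat => b /andP[b1 _].
rewrite -mulrA; apply: ler_wpM2l => //.
under eq_bigr do rewrite natrM invfM.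
rewrite -mulr_suml mulrC; apply: ler_wpM2l; rewrite ?invr_ge0 //.
by apply: harm_le; rewrite leq_div.
Qed.

Lemma sum_inv_multiples p X : (0 < p)%N ->
  \sum_(1 <= a < X.+1) (p %| a)%N%:R * a%:R^-1 <= p%:R^-1 * harm X :> R.
Proof.
move=> p0; under eq_bigr do rewrite mulr_natl mulrb.
rewrite -big_mkcond sum_multiples //.
under eq_bigr do rewrite natrM invfM.
rewrite -mulr_suml mulrC ler_wpM2l ?invr_ge0 //.
by apply: harm_le; rewrite leq_div.
Qed.

Lemma dvdn_mul_le p a b : prime p ->
  (p %| a * b)%N%:R <= (p %| b)%N%:R + (p %| a)%N%:R :> R.
Proof. by move=> pp; rewrite Euclid_dvdM // -natrD ler_nat; do 2!case: (p %| _)%N. Qed.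

(** A prime dividing a product of [k] factors divides one of them, and restricting that factor to
    multiples of [p] costs [1 / p]; the union bound over the [k] choices gives [k / p]. *)
Lemma lsum_dvd_le k p X : prime p ->
  \sum_(1 <= q < X.+1) (divk k q)%:R * ((p %| q)%N%:R * q%:R^-1) <=
  k%:R / p%:R * harm X ^+ k :> R.
Proof.
move=> pp; have p0 := prime_gt0 pp; elim: k => [|k IH].
  rewrite !mul0r big1_seq // => i _; rewrite divk0; case: eqP => [->|]; rewrite ?mul0r //.
  by rewrite dvdn1 gtn_eqF ?prime_gt1 // !mul0r mulr0.
rewrite sum_divkS.
apply: (@le_trans _ _ (\sum_(1 <= b < X.+1) ((divk k b)%:R * ((p %| b)%N%:R * b%:R^-1) * harm X
    + (divk k b)%:R * b%:R^-1 * (p%:R^-1 * harm X)))).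
  apply: ler_sum_nat => b /andP[b1 _]; rewrite -!mulrA -mulrDr; apply: ler_wpM2l => //.
  have bX : (X %/ b <= X)%N by rewrite leq_div.
  apply: (@le_trans _ _ (\sum_(1 <= a < (X %/ b).+1)
     ((p %| b)%N%:R * b%:R^-1 * a%:R^-1 + b%:R^-1 * ((p %| a)%N%:R * a%:R^-1)))).
    apply: ler_sum => a _; rewrite natrM invfM.
    apply: le_trans (ler_wpM2r _ (dvdn_mul_le a b pp)) _; first by rewrite mulr_ge0 ?invr_ge0.
    by rewrite le_eqVlt; apply/orP; left; apply/eqP; ring.
  rewrite big_split /= -!mulr_sumr !mulrA; apply: lerD.
    by apply: ler_wpM2l; rewrite ?mulr_ge0 ?invr_ge0 //; apply: harm_le.
  rewrite -mulrA; apply: ler_wpM2l; rewrite ?invr_ge0 //.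
  apply: le_trans (sum_inv_multiples _ p0) _.
  by apply: ler_wpM2l; rewrite ?invr_ge0 //; apply: harm_le.
rewrite big_split /= -!mulr_suml.
apply: le_trans (lerD (ler_wpM2r (harm_ge0 X) IH) (ler_wpM2r _ (lsum_le k X))) _.
  by rewrite mulr_ge0 ?invr_ge0 ?harm_ge0.
by rewrite exprSr -natr1 le_eqVlt; apply/orP; left; apply/eqP; ring.
Qed.

(** One factor is counted without weight and supplies the length [X / b]; the other [k] keep
    reciprocal weights. The prime may sit in any of the [k + 1]. *)
Lemma dsum_dvd_le k p X : prime p ->
  \sum_(1 <= n < X.+1) (divk k.+1 n)%:R * (p %| n)%N%:R <=
  k.+1%:R / p%:R * (X%:R * harm X ^+ k) :> R.
Proof.
move=> pp; have p0 := prime_gt0 pp; rewrite sum_divkS.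
have tr (b c : nat) : (0 < b)%N -> (c %/ b)%:R <= c%:R / b%:R :> R.
  by move=> b0; rewrite ler_pdivlMr ?ltr0n // -natrM ler_nat leq_trunc_div.
apply: (@le_trans _ _ (\sum_(1 <= b < X.+1) ((divk k b)%:R * ((p %| b)%N%:R * b%:R^-1) * X%:R
    + (divk k b)%:R * b%:R^-1 * (p%:R^-1 * X%:R)))).
  apply: ler_sum_nat => b /andP[b1 _]; rewrite -!mulrA -mulrDr; apply: ler_wpM2l => //.
  apply: (@le_trans _ _ (\sum_(1 <= a < (X %/ b).+1) ((p %| b)%N%:R + (p %| a)%N%:R))).
    by apply: ler_sum => a _; exact: dvdn_mul_le.
  rewrite big_split /=; apply: lerD.
    by rewrite sumr_const_nat subn1 -[X in X <= _]mulr_natr ler_wpM2l // mulrC tr.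
  under eq_bigr do rewrite mulrb.
  rewrite -big_mkcond sum_multiples // sumr_const_nat subn1.
  apply: le_trans (tr _ _ p0) _; rewrite mulrC mulrCA ler_wpM2l ?invr_ge0 // mulrC tr //.
rewrite big_split /= -!mulr_suml.
apply: le_trans (lerD (ler_wpM2r (ler0n _ X) (lsum_dvd_le k X pp)) (ler_wpM2r _ (lsum_le k X))) _.
  by rewrite mulr_ge0 ?invr_ge0.
by rewrite -natr1 le_eqVlt; apply/orP; left; apply/eqP; ring.
Qed.

End Upper.

(** * Divisor sums over integers coprime to Q *)

Section Lower.
Variable R : realType.
Implicit Types (k Q X Y N : nat).

Lemma sum_hyperbola X (F : nat -> nat -> R) :
  \sum_(1 <= b < X.+1) \sum_(1 <= a < (X %/ b).+1) F a b =
  \sum_(1 <= a < X.+1) \sum_(1 <= b < (X %/ a).+1) F a b.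
Proof.
have E (G : nat -> nat -> R) : \sum_(1 <= b < X.+1) \sum_(1 <= a < (X %/ b).+1) G a b =
    \sum_(1 <= b < X.+1) \sum_(1 <= a < X.+1 | (a * b <= X)%N) G a b.
  apply: eq_big_nat => b /andP[b1 _]; rewrite (big_nat_widen _ _ X.+1) ?ltnS ?leq_div //.
  by apply: eq_bigl => a; rewrite ltnS leq_divRL.
rewrite !E (exchange_big_dep predT) //=; apply: eq_bigr => a _; apply: eq_bigl => b.
by rewrite mulnC.
Qed.

(* Each block [Q i, Q (i + 1)) contains phi(Q) integers coprime to Q; Q > 1 excludes
   the junk class of 0, which is coprime to Q = 1. *)
Lemma sum_coprime_block Q N (f : nat -> R) : (1 < Q)%N ->
  (forall a b, (0 < a)%N -> (a <= b)%N -> (b <= Q * N)%N -> f b <= f a) ->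
  (totient Q)%:R * \sum_(1 <= i < N.+1) f (Q * i)%N <=
  \sum_(1 <= a < Q * N) (coprime Q a)%:R * f a.
Proof.
move=> Q1; elim: N => [|N IH] fle.
  by rewrite muln0 !big_geq // mulr0.
have fle' a b : (0 < a)%N -> (a <= b)%N -> (b <= Q * N)%N -> f b <= f a.
  move=> a0 ab bQ; apply: fle => //; apply: leq_trans bQ _; by rewrite leq_pmul2l // ltnW.
rewrite big_nat_recr //= mulrDr.
have block : (totient Q)%:R * f (Q * N.+1)%N <=
    \sum_(maxn 1 (Q * N) <= a < Q * N.+1) (coprime Q a)%:R * f a.
  rewrite totient_count_coprime natr_sum mulr_suml.
  have -> : \sum_(maxn 1 (Q * N) <= a < Q * N.+1) (coprime Q a)%:R * f a =
     \sum_(Q * N <= a < Q * N.+1) (coprime Q a)%:R * f a.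
    case: (posnP N) => [->|N0].
      rewrite muln0 muln1 [RHS]big_ltn ?(ltnW Q1) //.
      by rewrite /coprime gcdn0 gtn_eqF // mul0r add0r.
    by rewrite (maxn_idPr _) // muln_gt0 N0 (ltnW Q1).
  rewrite -{1}[(Q * N)%N]add0n big_addn.
  have -> : (Q * N.+1 - Q * N = Q)%N by rewrite mulnS addnK.
  apply: ler_sum_nat => d /andP[_ dQ].
  have -> : coprime Q (d + Q * N) = coprime Q d by rewrite /coprime addnC mulnC gcdnMDl.
  case: (boolP (coprime Q d)) => [cQd|_]; last by rewrite !mul0r.
  rewrite !mul1r; apply: fle => //; last by rewrite mulnS leq_add2r ltnW.
  by rewrite addn_gt0; case: d dQ cQd => [|//]; rewrite /coprime gcdn0 => _ /eqP E; rewrite E in Q1.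
apply: le_trans (lerD (IH fle') block) _.
case: (posnP N) => [->|N0].
  by rewrite muln0 [X in X + _]big_geq // add0r.
rewrite (maxn_idPr _) ?muln_gt0 ?N0 ?(ltnW Q1) //.
rewrite [leRHS](big_cat_nat _ (n := (Q * N)%N)) //= ?muln_gt0 ?N0 ?(ltnW Q1) //.
by rewrite leq_pmul2l ?(ltnW Q1).
Qed.

Lemma exprB_le (u v : R) j : 0 <= v -> v <= u ->
  u ^+ j.+1 - v ^+ j.+1 <= j.+1%:R * (u ^+ j * (u - v)).
Proof.
move=> v0 vu; have u0 := le_trans v0 vu; elim: j => [|j IH].
  by rewrite !expr1 expr0 !mul1r.
have -> : u ^+ j.+2 - v ^+ j.+2 = u * (u ^+ j.+1 - v ^+ j.+1) + v ^+ j.+1 * (u - v).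
  by rewrite !exprS; ring.
apply: le_trans (lerD (ler_wpM2l u0 IH) (ler_wpM2r _ (_ : _ <= u ^+ j.+1))) _.
- by rewrite subr_ge0.
- by rewrite lerXn2r // nnegrE.
by rewrite -[j.+2%:R]natr1 exprS le_eqVlt; apply/orP; left; apply/eqP; ring.
Qed.

Lemma ln_divS_le (i : nat) : (0 < i)%N -> ln (i.+1%:R / i%:R) <= i%:R^-1 :> R.
Proof.
move=> i0; have i0' : i%:R != 0 :> R by rewrite pnatr_eq0 -lt0n.
rewrite -natr1 mulrDl divff // mul1r; apply: le_ln1Dx.
by apply: (@lt_le_trans _ _ 0); rewrite ?invr_ge0 // oppr_lt0.
Qed.

(** Comparison with the integral of [ln (y / t) ^ j / t] over [[1, y]], done by telescoping its
    antiderivative [G] up to sign; [exprB_le] takes the place of the mean value theorem. *)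
Lemma sum_ln_ge j X (y : R) : (0 < X)%N -> X%:R <= y -> y < X.+1%:R ->
  ln y ^+ j.+1 / j.+1%:R <= \sum_(1 <= i < X.+1) i%:R^-1 * ln (y / i%:R) ^+ j.
Proof.
move=> X0 Xy yX; pose G (i : nat) := ln (y / i%:R) ^+ j.+1 / j.+1%:R.
have pos (i : nat) : (0 < i)%N -> 0 < i%:R :> R by rewrite ltr0n.
have y0 : 0 < y by apply: lt_le_trans Xy; exact: pos.
have lnge0 (i : nat) : (0 < i)%N -> (i <= X)%N -> 0 <= ln (y / i%:R).
  move=> i0 iX; apply: ln_ge0; rewrite ler_pdivlMr ?pos // mul1r.
  by apply: le_trans Xy; rewrite ler_nat.
have step i : (0 < i)%N -> (i < X)%N -> G i - G i.+1 <= i%:R^-1 * ln (y / i%:R) ^+ j.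
  move=> i0 iX; have u0 := lnge0 _ i0 (ltnW iX); have v0 := lnge0 i.+1 isT iX.
  have uv : ln (y / i%:R) - ln (y / i.+1%:R) = ln (i.+1%:R / i%:R).
    by rewrite -ln_div ?posrE ?divr_gt0 ?pos // invf_div mulrC mulrA divfK // gt_eqF.
  have vu : ln (y / i.+1%:R) <= ln (y / i%:R).
    by rewrite -subr_ge0 uv ln_ge0 // ler_pdivlMr ?pos // mul1r ler_nat.
  rewrite /G -mulrBl ler_pdivrMr ?pos //; apply: le_trans (exprB_le j v0 vu) _.
  rewrite uv [leRHS]mulrC; apply: ler_wpM2l => //; rewrite mulrC.
  by apply: ler_wpM2r; rewrite ?exprn_ge0 // ln_divS_le.
have tele N : (0 < N)%N -> (N <= X)%N ->
    G 1%N - G N <= \sum_(1 <= i < N) i%:R^-1 * ln (y / i%:R) ^+ j.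
  elim: N => // -[_ _ _|N IH _ NX]; first by rewrite subrr big_geq.
  rewrite big_nat_recr //=; apply: le_trans (lerD (IH isT (ltnW NX)) (step N.+1 isT NX)).
  by rewrite addrA subrK.
rewrite big_nat_recr //=.
(* Telescoping stops before [i = X], and that last term has to absorb the leftover [G X]: as
   [y < X + 1], one factor [ln (y / X)] is at most [1 / X]. *)
have := lerD (tele X X0 (leqnn X)) (_ : G X <= X%:R^-1 * ln (y / X%:R) ^+ j).
rewrite subrK (_ : G 1%N = ln y ^+ j.+1 / j.+1%:R); last by rewrite /G divr1.
apply.
have u0 := lnge0 X X0 (leqnn X).
rewrite /G ler_pdivrMr ?pos // exprS.
apply: (@le_trans _ _ (X%:R^-1 * ln (y / X%:R) ^+ j)).
  apply: ler_wpM2r; first by rewrite exprn_ge0.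
  apply: le_trans (ln_divS_le X0); rewrite ler_ln ?posrE ?divr_gt0 ?pos //.
  by rewrite ler_wpM2r ?invr_ge0 // ltW.
by rewrite ler_peMr ?ler1n // mulr_ge0 ?invr_ge0 ?exprn_ge0.
Qed.

End Lower.

Section Rough.
Variables (R : realType) (Q : nat).
Hypothesis Q1 : (1 < Q)%N.
Implicit Types (k X N : nat).

Definition tdens : R := (totient Q)%:R / Q%:R.
Definition rough_lsum k X : R :=
  \sum_(1 <= q < X.+1) (divk k q)%:R * ((coprime Q q)%:R * q%:R^-1).
Definition rough_dsum k X : R := \sum_(1 <= n < X.+1) (divk k n)%:R * (coprime Q n)%:R.

Let Q0 : 0 < Q%:R :> R. Proof. by rewrite ltr0n ltnW. Qed.

Lemma tdens_gt0 : 0 < tdens.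
Proof. by rewrite divr_gt0 // ltr0n totient_gt0 ltnW. Qed.

Lemma rough_lsum_ge0 k X : 0 <= rough_lsum k X.
Proof. by apply: sumr_ge0 => i _; rewrite !mulr_ge0 ?invr_ge0. Qed.

Lemma rough_lsumS k X :
  rough_lsum k.+1 X =
  \sum_(1 <= a < X.+1) (coprime Q a)%:R * (a%:R^-1 * rough_lsum k (X %/ a)).
Proof.
rewrite /rough_lsum sum_divkS.
under eq_bigr do rewrite mulr_sumr.
rewrite (sum_hyperbola X (fun a b => (divk k b)%:R *
   ((coprime Q (a * b))%:R * (a * b)%:R^-1) : R)).
apply: eq_bigr => a _; rewrite !mulr_sumr; apply: eq_bigr => b _.
by rewrite coprimeMr -mulnb !natrM invfM; ring.
Qed.

(** Each of the [k] factors is summed over blocks of length [Q]. This yields one density [tdens] and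
    one integration of the logarithm per factor, and divides the argument of the logarithm by [Q].
    The loss [Q ^ k] is constant in [y], so the leading term is not affected. *)
Lemma rough_lsum_ge k X (y : R) : Q%:R ^+ k <= y -> y < X.+1%:R ->
  tdens ^+ k / k`!%:R * ln (y / Q%:R ^+ k) ^+ k <= rough_lsum k X.
Proof.
elim: k X y => [|k IH] X y Qy yX.
  have X0 : (0 < X)%N by rewrite -ltnS -(ltr_nat R); apply: le_lt_trans Qy yX.
  rewrite !expr0 fact0 divr1 mulr1 /rough_lsum big_ltn ?ltnS // divk_1 coprimen1 invr1 !mul1r.
  by rewrite lerDl sumr_ge0 // => i _; rewrite !mulr_ge0 ?invr_ge0.
have Qk (j : nat) : 0 < Q%:R ^+ j :> R by exact: exprn_gt0.
(* With [X'] blocks, every [a <= Q * X'] still satisfies [Q ^ k <= y / a], as the induction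
   hypothesis requires; the logarithms in [f] are then nonnegative and [f] is decreasing. *)
pose y' := y / Q%:R ^+ k.+1; pose X' := Num.truncn y'.
have y'1 : 1 <= y' by rewrite ler_pdivlMr // mul1r.
have y'0 : 0 <= y' by exact: le_trans ler01 y'1.
have [X'y y'X] : X'%:R <= y' /\ y' < X'.+1%:R by apply/andP; exact: truncn_itv.
have X'0 : (0 < X')%N by rewrite -ltnS -(ltr_nat R); apply: le_lt_trans y'1 y'X.
have X'y2 : X'%:R * Q%:R ^+ k.+1 <= y by rewrite -ler_pdivlMr.
have QX : (Q * X' <= X)%N.
  rewrite -ltnS -(ltr_nat R); apply: le_lt_trans yX; apply: le_trans X'y2.
  rewrite natrM mulrC; apply: ler_wpM2l => //; rewrite exprS ler_peMr ?(ltW Q0) //.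
  by rewrite exprn_ege1 // ler1n ltnW.
pose c := tdens ^+ k / k`!%:R.
have c0 : 0 <= c by rewrite divr_ge0 // exprn_ge0 // ltW // tdens_gt0.
pose f (a : nat) := a%:R^-1 * (c * ln (y / a%:R / Q%:R ^+ k) ^+ k).
have aQ (a : nat) : (a <= Q * X')%N -> a%:R * Q%:R ^+ k <= y.
  move=> aX; apply: le_trans X'y2.
  rewrite (_ : _ * _ ^+ k.+1 = (Q * X')%:R * Q%:R ^+ k); last by rewrite natrM exprS; ring.
  by rewrite ler_wpM2r ?(ltW (Qk _)) // ler_nat.
have lnge (a : nat) : (0 < a)%N -> (a <= Q * X')%N -> 1 <= y / a%:R / Q%:R ^+ k.
  by move=> a0 aX; rewrite !ler_pdivlMr ?ltr0n // mul1r mulrC aQ.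
have ypos : 0 < y by apply: lt_le_trans Qy.
have fle a b : (0 < a)%N -> (a <= b)%N -> (b <= Q * X')%N -> f b <= f a.
  move=> a0 ab bX; have b0 := leq_trans a0 ab; have aX := leq_trans ab bX.
  apply: ler_pM; rewrite ?invr_ge0 //.
  - by rewrite mulr_ge0 // exprn_ge0 // ln_ge0 // lnge.
  - by rewrite lef_pV2 ?posrE ?ltr0n // ler_nat.
  apply: ler_wpM2l => //; rewrite lerXn2r // ?nnegrE ?ln_ge0 ?lnge //.
  rewrite ler_ln ?posrE ?divr_gt0 ?ltr0n //.
  rewrite ler_wpM2r ?invr_ge0 ?(ltW (Qk _)) // ler_wpM2l ?(ltW ypos) //.
  by rewrite lef_pV2 ?posrE ?ltr0n // ler_nat.
have := sum_coprime_block Q1 fle.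
have -> : (totient Q)%:R * \sum_(1 <= i < X'.+1) f (Q * i)%N =
    tdens * c * \sum_(1 <= i < X'.+1) i%:R^-1 * ln (y' / i%:R) ^+ k.
  rewrite !mulr_sumr; apply: eq_big_nat => i /andP[i0 _].
  have -> : y' / i%:R = y / (Q * i)%:R / Q%:R ^+ k.
    by rewrite /y' natrM exprS !invfM; ring.
  by rewrite /f natrM invfM /tdens; ring.
move=> /(le_trans (ler_wpM2l _ (sum_ln_ge k X'0 X'y y'X))) => /(_ (mulr_ge0 (ltW tdens_gt0) c0)).
have -> : tdens * c * (ln y' ^+ k.+1 / k.+1%:R) =
    tdens ^+ k.+1 / (k.+1)`!%:R * ln (y / Q%:R ^+ k.+1) ^+ k.+1.
  by rewrite factS natrM invfM /c [tdens ^+ k.+1]exprS -/y'; ring.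
move=> /le_trans; apply; rewrite rough_lsumS.
rewrite [leRHS](big_cat_nat _ (n := (Q * X')%N)) ?muln_gt0 ?X'0 ?(ltnW Q1) //=; last exact: leqW.
rewrite -[leLHS]addr0; apply: lerD; last first.
  by apply: sumr_ge0 => a _; rewrite !mulr_ge0 ?invr_ge0 ?rough_lsum_ge0.
apply: ler_sum_nat => a /andP[a0 aX]; apply: ler_wpM2l => //.
apply: ler_wpM2l; rewrite ?invr_ge0 //.
apply: IH; first by rewrite ler_pdivlMr ?ltr0n // mulrC aQ // ltnW.
rewrite ltr_pdivrMr ?ltr0n // -natrM; apply: lt_le_trans yX _.
by rewrite ler_nat -ltn_divLR.
Qed.

(** Only cofactors [b <= eps * x / Q] are kept. For these the incomplete block lost when counting
    integers coprime to [Q] up to [x / b] has length at most [Q <= eps * x / b], which accounts for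
    the factor [1 - eps]. *)
Lemma rough_dsum_ge k X (x eps : R) : 0 < eps -> eps <= 1 ->
  Q%:R ^+ k.+1 <= eps * x -> x < X.+1%:R ->
  (1 - eps) * x * (tdens ^+ k.+1 / k`!%:R * ln (eps * x / Q%:R ^+ k.+1) ^+ k) <=
  rough_dsum k.+1 X.
Proof.
move=> e0 e1 Qx xX.
have Qk (j : nat) : 0 < Q%:R ^+ j :> R by exact: exprn_gt0.
have x0 : 0 < x by rewrite -(pmulr_rgt0 _ e0); apply: lt_le_trans Qx.
pose y := eps * x / Q%:R; pose B := Num.truncn y.
have [By yB] : B%:R <= y /\ y < B.+1%:R.
  by apply/andP; apply: truncn_itv; rewrite ltW // divr_gt0 // mulr_gt0.
have Qy : Q%:R ^+ k <= y by rewrite ler_pdivlMr // -exprSr.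
have bX (b : nat) : (b <= B)%N -> b%:R * Q%:R <= eps * x.
  by move=> bB; rewrite -ler_pdivlMr //; apply: le_trans By; rewrite ler_nat.
have BX : (B <= X)%N.
  rewrite -ltnS -(ltr_nat R); apply: le_lt_trans xX; apply: (@le_trans _ _ (B%:R * Q%:R)).
    by rewrite ler_peMr // ler1n ltnW.
  by apply: le_trans (bX B (leqnn B)) _; rewrite -[leRHS]mul1r ler_wpM2r // ltW.
have := rough_lsum_ge Qy yB => /(ler_wpM2l (_ : 0 <= tdens * ((1 - eps) * x))).
have e1' : 0 <= 1 - eps by rewrite subr_ge0.
move=> /(_ (mulr_ge0 (ltW tdens_gt0) (mulr_ge0 e1' (ltW x0)))).
rewrite (_ : y / _ = eps * x / Q%:R ^+ k.+1) => [H|]; last by rewrite /y exprS invfM mulrA.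
 apply: le_trans (le_trans _ H) _.
  by rewrite [tdens ^+ k.+1]exprS le_eqVlt; apply/orP; left; apply/eqP; ring.
rewrite /rough_dsum sum_divkS [leRHS](big_cat_nat _ (n := B.+1)) //=.
rewrite -[leLHS]addr0; apply: lerD; last first.
  by apply: sumr_ge0 => a _; rewrite mulr_ge0 // sumr_ge0.
rewrite /rough_lsum mulr_sumr; apply: ler_sum_nat => b /andP[b0]; rewrite ltnS => bB.
rewrite mulrCA; apply: ler_wpM2l => //.
under eq_bigr do rewrite coprimeMr -mulnb natrM.
rewrite -mulr_suml [leRHS]mulrC mulrCA; apply: ler_wpM2l => //.
pose N := (X %/ b %/ Q)%N.
have QN : (Q * N <= X %/ b)%N by rewrite mulnC leq_trunc_div.
have H1 : (totient Q)%:R * N%:R <= \sum_(1 <= i < (X %/ b).+1) (coprime Q i)%:R :> R.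
  have := @sum_coprime_block R Q N (fun=> 1) Q1 (fun _ _ _ _ _ => lexx _).
  rewrite sumr_const_nat subn1 /= => /le_trans; apply.
  under eq_bigr do rewrite mulr1.
  case: (posnP N) => [->|N0]; first by rewrite muln0 big_geq // sumr_ge0.
  rewrite [leRHS](big_cat_nat _ (n := (Q * N)%N)) ?muln_gt0 ?N0 ?(ltnW Q1) //=; last exact: leqW.
  by rewrite lerDl sumr_ge0.
apply: le_trans H1; rewrite /tdens -!mulrA; apply: ler_wpM2l => //.
have bQ0 : 0 < b%:R * Q%:R :> R by rewrite mulr_gt0 // ltr0n.
have -> : Q%:R^-1 * ((1 - eps) * (x * b%:R^-1)) = (x - eps * x) / (b%:R * Q%:R).
  by rewrite invfM; ring.
rewrite ler_pdivrMr // lerBlDr; apply: (@le_trans _ _ ((N.+1 * (b * Q))%:R)).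
  apply: ltW; apply: lt_le_trans xX _; rewrite ler_nat.
  by rewrite -ltn_divLR ?muln_gt0 ?b0 ?(ltnW Q1) // divnMA.
by rewrite natrM -natr1 mulrDl mul1r natrM lerD2l bX.
Qed.

End Rough.

(** * The gcd condition *)

Section Totient.
Variable R : realType.

Lemma totient_le n : (totient n <= n)%N.
Proof.
rewrite totient_count_coprime -[leqRHS](subn0 n) -[leqRHS]muln1 -sum_nat_const_nat.
by apply: leq_sum => i _; case: coprime.
Qed.

Lemma tdensE n : (0 < n)%N -> (totient n)%:R / n%:R = \prod_(p <- primes n) (1 - p%:R^-1) :> R.
Proof.
move=> n0; have En : n = (\prod_(p <- primes n) p ^ logn p n)%N.
  by rewrite {1}(prod_prime_decomp n0) prime_decompE big_map.
rewrite [in X in X / _]totientE // [X in _ / X%:R]En !natr_prod -prodfV -big_split /=.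
apply: eq_big_seq => p; rewrite mem_primes => /and3P[pp _ pn].
have p0 : p%:R != 0 :> R by rewrite pnatr_eq0 -lt0n prime_gt0.
have : (0 < logn p n)%N by rewrite logn_gt0 mem_primes pp n0.
case: (logn p n) => // e _ /=.
rewrite natrM expnS natrM invfM mulrACA divff ?mulr1; last by rewrite pnatr_eq0 -lt0n expn_gt0 prime_gt0.
by rewrite -subn1 natrB ?prime_gt0 // mulrBl divff // mul1r.
Qed.

Lemma tdens_subset Q c : (0 < Q)%N -> (0 < c)%N -> {subset primes c <= primes Q} ->
  tdens R Q <= (totient c)%:R / c%:R.
Proof.
move=> Q0 c0 sub; rewrite /tdens !tdensE //.
have f01 p : p \in primes Q -> 0 <= 1 - p%:R^-1 :> R /\ 1 - p%:R^-1 <= 1 :> R.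
  rewrite mem_primes => /and3P[pp _ _]; rewrite subr_ge0 invf_le1 ?ltr0n ?prime_gt0 // ler1n prime_gt0 //.
rewrite [leLHS](bigID (mem (primes c))) /= -[leRHS]mulr1; apply: ler_pM.
- by rewrite big_seq_cond; apply: prodr_ge0 => p /andP[/f01[]].
- by rewrite big_seq_cond; apply: prodr_ge0 => p /andP[/f01[]].
- rewrite -big_filter (perm_big (primes c)) //.
  apply: uniq_perm; rewrite ?filter_uniq ?primes_uniq // => p.
  by rewrite mem_filter; case: (boolP (p \in primes c)) => //= /sub ->.
- by rewrite big_seq_cond; apply: prodr_ile1 => p /andP[/f01[-> ->]].
Qed.

End Totient.

(* [negn] is written out because [pi^'] would denote a punctured neighbourhood filter. *)
Section Split.
Variables (R : realType) (Q h : nat).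
Hypothesis Q1 : (1 < Q)%N.
Hypothesis h0 : (0 < h)%N.
Hypothesis hQ : \pi(Q).-nat h.
Implicit Types (k n q X Y N M : nat).

Local Notation pi := (\pi(Q)).

(** Each [n] has a single [tau]-part, so no term on the right is used twice on the left. Restricting
    that part to be below [M] keeps the outer sum finite and independent of [X]. *)
Lemma sum_partn_ge (tau : nat_pred) M X (F : nat -> R) : (forall n, 0 <= F n) ->
  \sum_(1 <= a < M | tau.-nat a) \sum_(1 <= n < (X %/ a).+1 | (negn tau).-nat n) F (a * n)%N <=
  \sum_(1 <= n < X.+1) F n.
Proof.
move=> F0.
apply: (@le_trans _ _ (\sum_(1 <= a < M | tau.-nat a)
   \sum_(1 <= n < X.+1) ((partn n tau) == a)%:R * F n)).
  rewrite big_nat_cond [leRHS]big_nat_cond; apply: ler_sum => a /andP[/andP[a0 _] ta].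
  rewrite big_mkcond /=.
  rewrite (eq_bigr (fun n => ((negn tau).-nat (n * a %/ a)%N)%:R * F (n * a)%N)); last first.
    by move=> n _; rewrite mulnK // mulnC mulr_natl mulrb.
  rewrite -(sum_multiples X (fun n => ((negn tau).-nat (n %/ a)%N)%:R * F n)) //.
  rewrite big_mkcond /=; apply: ler_sum_nat => n /andP[n0 _].
  case: ifP => [an|_]; last by rewrite mulr_ge0.
  case: (boolP ((negn tau).-nat (n %/ a)%N)) => [tn|_]; last by rewrite mul0r mulr_ge0.
  rewrite (_ : partn n tau = a) ?eqxx // -{1}(divnK an) partnM ?divn_gt0 ?(dvdn_leq n0 an) //.
  by rewrite (part_p'nat tn) (part_pnat_id ta) mul1n.
rewrite exchange_big /=; apply: ler_sum => n _; rewrite -mulr_suml.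
rewrite -[leRHS]mul1r; apply: ler_wpM2r => //.
rewrite -natr_sum -[1]/(1%:R) ler_nat.
rewrite (eq_bigr (fun a => ((partn n tau) == a : nat))) // -big_mkcondr sum1_count.
apply: (@leq_trans (count_mem (partn n tau) (index_iota 1 M))).
  by apply: sub_count => a /= /andP[_ /eqP ->].
by rewrite count_uniq_mem ?iota_uniq //; case: (_ \in _).
Qed.

Lemma gcdn_part_smooth q : (0 < q)%N -> gcdn h q = gcdn h (partn q pi).
Proof.
move=> q0; rewrite -{1}(partnC pi q0) Gauss_gcdl //.
apply: pnat_coprime hQ _; exact: part_pnat.
Qed.

(* With q = b q', b being the pi(Q)-part: the lower bound 1 / (q' phi(b / gcd(h, b))) for
   1 / phi(q / gcd(h, q)), obtained from phi(q') <= q'. *)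
Definition smooth_wt q : R :=
  ((partn q (negn pi))%:R * (totient (partn q pi %/ gcdn h (partn q pi)))%N%:R)^-1.

Lemma totient_le_smooth_wt q : (0 < q)%N ->
  (totient (q %/ gcdn h q) <=
     partn q (negn pi) * totient (partn q pi %/ gcdn h (partn q pi)))%N.
Proof.
move=> q0; rewrite gcdn_part_smooth //; set g := gcdn h _.
have -> : (q %/ g = (partn q pi) %/ g * (partn q (negn pi)))%N.
  by rewrite -{1}(partnC pi q0) divn_mulAC // dvdn_gcdr.
rewrite totient_coprime; last first.
  apply: (@pnat_coprime pi); last exact: part_pnat.
  by apply: pnat_dvd (part_pnat pi q); rewrite -{2}(divnK (dvdn_gcdr h (partn q pi))) dvdn_mulr.
by rewrite mulnC leq_mul2r totient_le orbT.
Qed.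

Lemma smooth_wt_ge0 q : 0 <= smooth_wt q.
Proof. by rewrite invr_ge0 mulr_ge0. Qed.

Lemma totient_quot_gt0 q : (0 < q)%N -> (0 < totient (q %/ gcdn h q))%N.
Proof. by move=> q0; rewrite totient_gt0 divn_gt0 ?gcdn_gt0 ?h0 // dvdn_leq ?dvdn_gcdr. Qed.

Lemma smooth_wt_le_totient q : (0 < q)%N -> smooth_wt q <= (totient (q %/ gcdn h q))%N%:R^-1.
Proof.
move=> q0; rewrite /smooth_wt -natrM lef_pV2 ?posrE ?ltr0n ?totient_quot_gt0 //.
  by rewrite ler_nat totient_le_smooth_wt.
by rewrite muln_gt0 part_gt0 totient_quot_gt0.
Qed.

(** Meant for error terms only, where a constant may be lost. The quotient [b / gcd(h, b)] has no
    primes outside [Q], so its totient is at least [tdens] times itself, and the gcd is at most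
    [h]. *)
Lemma smooth_wt_le q : (0 < q)%N -> smooth_wt q <= h%:R / tdens R Q * q%:R^-1.
Proof.
move=> q0; set b := (partn q pi); set g := gcdn h b.
have b0 : (0 < b)%N by exact: part_gt0.
have gb : (g %| b)%N by exact: dvdn_gcdr.
have g0 : (0 < g)%N by rewrite gcdn_gt0 h0.
have bg : (b %/ g %| b)%N by apply/dvdnP; exists g; rewrite mulnC divnK.
have c0 : (0 < b %/ g)%N by rewrite divn_gt0 // dvdn_leq.
have r0 := tdens_gt0 R Q1.
have t0 : (0 < totient (b %/ g))%N by rewrite totient_gt0.
have rc : tdens R Q * (b %/ g)%N%:R <= (totient (b %/ g))%N%:R.
  rewrite -ler_pdivlMr ?ltr0n //; apply: tdens_subset => //; first exact: ltnW.
  move=> p; rewrite mem_primes => /and3P[pp _ pc].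
  have : (p \in pi) by apply: (pnatPpi (part_pnat pi q)); rewrite mem_primes pp b0 /= (dvdn_trans pc).
  by [].
rewrite /smooth_wt -/b -/g; set c := (partn q (negn pi))%:R; set t := (totient _)%:R in rc *.
have c1 : 0 < c by rewrite ltr0n part_gt0.
have t1 : 0 < t by rewrite ltr0n.
have key : tdens R Q * q%:R <= h%:R * (c * t).
  rewrite -{1}(partnC pi q0) -/b natrM -/c [leRHS]mulrCA mulrA mulrC; apply: ler_wpM2l; first exact: ltW.
  apply: (@le_trans _ _ (tdens R Q * (g%:R * (b %/ g)%N%:R))).
    by rewrite -natrM mulnC divnK.
  rewrite mulrCA; apply: ler_pM => //; first by rewrite mulr_ge0 // ltW.
  by rewrite ler_nat dvdn_leq // dvdn_gcdl.
rewrite -[leLHS]mul1r ler_pdivrMr ?mulr_gt0 //.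
have -> : h%:R / tdens R Q / q%:R * (c * t) = h%:R * (c * t) / (tdens R Q * q%:R).
  by rewrite (invfM (tdens R Q)); ring.
by rewrite ler_pdivlMr ?mul1r // mulr_gt0 // ltr0n.
Qed.

(** If the smooth parts meet the gcd condition but [n] and [q] do not, the rough parts share a
    prime. It does not divide [Q], hence exceeds [z], and the subtracted sum counts it. *)
Lemma gcd_indicator_ge z n q Y : (0 < n)%N -> (0 < q)%N -> (q <= Y)%N ->
  (forall p, prime p -> (p <= z)%N -> (p %| Q)%N) ->
  (gcdn (partn n pi) (partn q pi) == gcdn h (partn q pi))%:R
   - \sum_(z.+1 <= p < Y.+1 | prime p) ((p %| n)%N%:R * (p %| q)%N%:R) <=
  (gcdn n q == gcdn h q)%:R :> R.
Proof.
move=> n0 q0 qY zQ.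
have S0 : 0 <= \sum_(z.+1 <= p < Y.+1 | prime p) ((p %| n)%N%:R * (p %| q)%N%:R) :> R.
  by apply: sumr_ge0 => p _; rewrite mulr_ge0.
case: (boolP (_ == _)) => [/eqP E|_]; last by rewrite sub0r (le_trans _ (ler0n _ _)) // oppr_le0.
set d := gcdn (partn n (negn pi)) (partn q (negn pi)).
have d0 : (0 < d)%N by rewrite gcdn_gt0 part_gt0.
have pn m : (negn pi).-nat (partn m (negn pi)) by exact: part_pnat.
have [d1|dn1] := eqVneq d 1%N.
  rewrite (_ : gcdn n q = gcdn h q) ?eqxx ?gerBl //.
  rewrite (gcdn_part_smooth q0) -E -{1}(partnC pi n0) -{1}(partnC pi q0).
  have cop m m' : coprime (partn m pi) (partn m' (negn pi)) by apply: (@pnat_coprime pi); exact: part_pnat.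
  rewrite Gauss_gcdl; last by rewrite coprimeMl cop -/d /coprime -/d d1.
  by rewrite [LHS]gcdnC Gauss_gcdl ?cop // gcdnC.
set p := pdiv d.
have pp : prime p by apply: pdiv_prime; rewrite ltn_neqAle eq_sym dn1.
have pd : (p %| d)%N by exact: pdiv_dvd.
have pn' : (p %| n)%N by rewrite (dvdn_trans pd) // (dvdn_trans (dvdn_gcdl _ _)) // dvdn_part.
have pq' : (p %| q)%N by rewrite (dvdn_trans pd) // (dvdn_trans (dvdn_gcdr _ _)) // dvdn_part.
have pz : (z < p)%N.
  rewrite ltnNge; apply/negP => /(zQ p pp) pQ.
  have := pnatPpi (pn n) (_ : p \in \pi(partn n (negn pi))).
  rewrite mem_primes pp part_gt0 (dvdn_trans pd (dvdn_gcdl _ _)) => /(_ isT).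
  by rewrite inE /= mem_primes pp (ltnW Q1) pQ.
apply: le_trans (ler0n _ _); rewrite subr_le0.
rewrite big_mkcond (bigD1_seq p) ?iota_uniq //=; last first.
  by rewrite mem_index_iota pz ltnS (leq_trans _ qY) // dvdn_leq.
by rewrite pp pn' pq' mulr1 lerDl sumr_ge0 // => i _; case: ifP; rewrite ?mulr_ge0.
Qed.

End Split.

(** * The double sum over [n] and [q], split into smooth and rough parts *)

Section Main.
Variables (R : realType) (Q h : nat).
Hypothesis Q1 : (1 < Q)%N.
Hypothesis h0 : (0 < h)%N.
Hypothesis hQ : \pi(Q).-nat h.
Implicit Types (k m n q X Y N M z : nat).

Local Notation pi := (\pi(Q)).
Local Notation w := (@smooth_wt R Q h).

(** Contribution of the smooth parts [a] of [n] and [b] of [q] to the main term: [1 / a] is the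
    density of multiples of [a], and the totient is what [smooth_wt] retains of [b]. *)
Definition pair_wt k m a b : R :=
  (gcdn a b == gcdn h b)%:R * (divk k a)%:R * (divk m b)%:R /
  (a%:R * (totient (b %/ gcdn h b)%N)%:R).

Lemma sum_inv_sq z N : (0 < z)%N -> \sum_(z.+1 <= p < N) p%:R ^- 2 <= z%:R^-1 :> R.
Proof.
move=> z0; case: (leqP N z.+1) => [Nz|zN]; first by rewrite big_geq // invr_ge0.
have H d : \sum_(z.+1 <= p < z.+1 + d) p%:R ^- 2 <= z%:R^-1 - (z + d)%:R^-1 :> R.
  elim: d => [|d IH]; first by rewrite !addn0 big_geq // subrr.
  rewrite addnS big_nat_recr ?leq_addr //=; apply: le_trans (lerD IH (lexx _)) _.
  rewrite -addrA lerD2l addSn addnS; set c := (z + d)%N.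
  have c0 : (0 < c)%N by rewrite addn_gt0 z0.
  have cR : 0 < c%:R :> R by rewrite ltr0n.
  have cS : 0 < c.+1%:R :> R by [].
  rewrite -subr_ge0.
  have -> : - c.+1%:R^-1 - (- c%:R^-1 + c.+1%:R ^- 2) = (c%:R * c.+1%:R ^+ 2)^-1 :> R.
    by rewrite -natr1; field; rewrite natr1 !gt_eqF.
  by rewrite invr_ge0 mulr_ge0 // exprn_ge0.
rewrite -(subnKC (ltnW zN)); apply: le_trans (H _) _.
by rewrite gerDl oppr_le0 invr_ge0.
Qed.

Lemma rough_sumE N (F : nat -> R) :
  \sum_(1 <= n < N | (negn pi).-nat n) F n = \sum_(1 <= n < N) F n * (coprime Q n)%:R.
Proof.
rewrite big_mkcond; apply: eq_big_nat => n /andP[n0 _].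
by rewrite coprime_pi' ?(ltnW Q1) // mulr_natr mulrb.
Qed.

(** The gcd condition here involves [a] and [b] alone and the divisor functions are multiplicative,
    so the sums over the rough parts decouple. The extra factor [a] cancels the [1 / a] in
    [pair_wt], because [rough_dsum] up to [X / a] already carries that density. *)
Lemma split_sum_ge k m M X Y :
  \sum_(1 <= b < M | pi.-nat b) \sum_(1 <= a < M | pi.-nat a)
     pair_wt k m a b * (a%:R * rough_dsum R Q k (X %/ a) * rough_lsum R Q m (Y %/ b)) <=
  \sum_(1 <= q < Y.+1) \sum_(1 <= n < X.+1)
     (gcdn (partn n pi) (partn q pi) == gcdn h (partn q pi))%:R *
       ((divk k n)%:R * ((divk m q)%:R * w q)).
Proof.
set F := fun q n => (gcdn (partn n pi) (partn q pi) == gcdn h (partn q pi))%:R *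
       ((divk k n)%:R * ((divk m q)%:R * w q)).
have F0 q n : 0 <= F q n by rewrite !mulr_ge0 ?smooth_wt_ge0.
apply: le_trans (sum_partn_ge pi M Y (F := fun q => \sum_(1 <= n < X.+1) F q n) _); last first.
  by move=> q; apply: sumr_ge0.
rewrite big_nat_cond [leRHS]big_nat_cond; apply: ler_sum => b /andP[/andP[b0 _] pb].
apply: (@le_trans _ _ (\sum_(1 <= q < (Y %/ b).+1 | (negn pi).-nat q)
   \sum_(1 <= a < M | pi.-nat a) \sum_(1 <= n < (X %/ a).+1 | (negn pi).-nat n) F (b * q)%N (a * n)%N)); last first.
  by apply: ler_sum => q _; apply: sum_partn_ge.
rewrite (exchange_big_dep (fun a => pi.-nat a)) //=.
rewrite big_nat_cond [leRHS]big_nat_cond; apply: ler_sum => a /andP[/andP[a0 _] pa].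
have -> N : rough_lsum R Q m N = \sum_(1 <= q < N.+1 | (negn pi).-nat q) (divk m q)%:R / q%:R.
  by rewrite rough_sumE; apply: eq_bigr => q _; rewrite mulrCA mulrC.
rewrite /rough_dsum -rough_sumE.
rewrite le_eqVlt; apply/orP; left; apply/eqP.
rewrite [X in _ * X = _]mulr_sumr [LHS]mulr_sumr [LHS]big_nat_cond [RHS]big_nat_cond.
apply: eq_big => [q|q /andP[/andP[q0 _] pq]]; first by rewrite pa andbT.
 rewrite [X in _ * (X * _)]mulr_sumr [X in _ * X]mulr_suml [LHS]mulr_sumr [LHS]big_nat_cond [RHS]big_nat_cond.
apply: eq_bigr => n /andP[/andP[n0 _] pn].
have part1 x y : (0 < x)%N -> (0 < y)%N -> pi.-nat x -> (negn pi).-nat y ->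
    partn (x * y) pi = x /\ partn (x * y) (negn pi) = y.
  move=> x0 y0 px py; rewrite !partnM // (part_pnat_id px) (part_p'nat py).
  by rewrite (part_pnat_id py) part_p'nat ?muln1 ?mul1n // pnatNK.
have cop x y : pi.-nat x -> (negn pi).-nat y -> coprime x y by exact: pnat_coprime.
have [Ea _] := part1 _ _ a0 n0 pa pn; have [Eb Eq] := part1 _ _ b0 q0 pb pq.
rewrite /F /smooth_wt Ea Eb Eq /pair_wt !divkM ?cop // !natrM !invfM.
have an0 : a%:R != 0 :> R by rewrite pnatr_eq0 -lt0n.
rewrite -[RHS](mulVKf an0); ring.
Qed.

(** Divisibility of [n] and of [q] by [p] saves [1 / p] each, and the resulting [p^-2] sums to at
    most [1 / z] beyond [z]. *)
Lemma dvdn_error_le k m z X Y : (0 < z)%N ->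
  \sum_(z.+1 <= p < Y.+1 | prime p)
    (\sum_(1 <= n < X.+1) (divk k.+1 n)%:R * (p %| n)%N%:R) *
    (\sum_(1 <= q < Y.+1) (divk m q)%:R * ((p %| q)%N%:R * w q)) <=
  k.+1%:R * m%:R * (h%:R / tdens R Q) / z%:R * (X%:R * harm R X ^+ k * harm R Y ^+ m).
Proof.
move=> z0; have r0 := tdens_gt0 R Q1.
have c0 : 0 <= h%:R / tdens R Q by rewrite divr_ge0 // ltW.
set C := k.+1%:R * m%:R * (h%:R / tdens R Q) * (X%:R * harm R X ^+ k * harm R Y ^+ m).
have C0 : 0 <= C by rewrite !mulr_ge0 ?exprn_ge0 ?harm_ge0 ?invr_ge0 // ltW.
rewrite [leRHS](_ : _ = C * z%:R^-1); last by rewrite /C; ring.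
apply: le_trans (ler_wpM2l C0 (sum_inv_sq Y.+1 z0)).
rewrite mulr_sumr big_mkcond; apply: ler_sum_nat => p /andP[zp _].
case: ifP => [pp|_]; last by rewrite mulr_ge0 // invr_ge0 exprn_ge0.
apply: le_trans (ler_pM _ _ (dsum_dvd_le R k X pp) (_ : _ <= h%:R / tdens R Q * (m%:R / p%:R * harm R Y ^+ m))) _.
- by apply: sumr_ge0 => n _; rewrite mulr_ge0.
- by apply: sumr_ge0 => n _; rewrite !mulr_ge0 ?smooth_wt_ge0.
- apply: le_trans (ler_wpM2l c0 (lsum_dvd_le R m Y pp)).
  rewrite mulr_sumr; apply: ler_sum_nat => q /andP[q0 _].
  rewrite [leRHS]mulrCA; apply: ler_wpM2l => //; rewrite [leRHS]mulrCA; apply: ler_wpM2l => //.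
  exact: smooth_wt_le.
by rewrite /C -exprVn le_eqVlt; apply/orP; left; apply/eqP; ring.
Qed.

Lemma gcd_sum_ge k m M z X Y : (0 < z)%N ->
  (forall p, prime p -> (p <= z)%N -> (p %| Q)%N) ->
  \sum_(1 <= b < M | pi.-nat b) \sum_(1 <= a < M | pi.-nat a)
     pair_wt k.+1 m a b * (a%:R * rough_dsum R Q k.+1 (X %/ a) * rough_lsum R Q m (Y %/ b))
  - k.+1%:R * m%:R * (h%:R / tdens R Q) / z%:R * (X%:R * harm R X ^+ k * harm R Y ^+ m) <=
  \sum_(1 <= q < Y.+1) \sum_(1 <= n < X.+1)
     (gcdn n q == gcdn h q)%:R * ((divk k.+1 n)%:R * ((divk m q)%:R * w q)).
Proof.
move=> z0 zQ.
apply: le_trans (lerB (split_sum_ge k.+1 m M X Y) (dvdn_error_le k m X Y z0)) _.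
have -> : \sum_(z.+1 <= p < Y.+1 | prime p)
    (\sum_(1 <= n < X.+1) (divk k.+1 n)%:R * (p %| n)%N%:R) *
    (\sum_(1 <= q < Y.+1) (divk m q)%:R * ((p %| q)%N%:R * w q)) =
  \sum_(1 <= q < Y.+1) \sum_(1 <= n < X.+1)
     (\sum_(z.+1 <= p < Y.+1 | prime p) ((p %| n)%N%:R * (p %| q)%N%:R)) *
     ((divk k.+1 n)%:R * ((divk m q)%:R * w q)) :> R.
  under eq_bigr do rewrite mulrC mulr_suml.
  rewrite exchange_big /=; apply: eq_bigr => q _.
  under eq_bigr do rewrite mulr_sumr.
  rewrite exchange_big /=; apply: eq_bigr => n _.
  by rewrite mulr_suml; apply: eq_bigr => p _; ring.
rewrite -sumrB; apply: ler_sum_nat => q /andP[q0 qY].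
rewrite -sumrB; apply: ler_sum_nat => n /andP[n0 nX].
rewrite -mulrBl; apply: ler_wpM2r; first by rewrite !mulr_ge0 ?smooth_wt_ge0.
exact: gcd_indicator_ge.
Qed.

End Main.

(** * The Euler product *)

Section Local.
Variables (R : realType) (p : nat).
Hypothesis pp : prime p.
Implicit Types (k m b N : nat).

Local Notation x := (p%:R^-1 : R).
Local Notation term k b := ((divk k (p ^ b))%:R * p%:R ^- b : R).

Let p0 : 0 < p%:R :> R. Proof. by rewrite ltr0n prime_gt0. Qed.
Let x1 : x < 1. Proof. by rewrite invf_lt1 // ltr1n prime_gt1. Qed.
Let x0 : 0 < x. Proof. by rewrite invr_gt0. Qed.

Lemma divk_term_ge0 k b : 0 <= term k b.
Proof. by rewrite mulr_ge0 // invr_ge0 exprn_ge0 // ltW. Qed.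

(* Generating-function identity (1 - x) S_{k+1} = S_k for partial sums, from
   d_{k+1}(p^(b+1)) = d_{k+1}(p^b) + d_k(p^(b+1)). *)
Lemma divk_series_rec k N :
  \sum_(0 <= b < N.+1) term k.+1 b =
  x * \sum_(0 <= b < N) term k.+1 b + \sum_(0 <= b < N.+1) term k b.
Proof.
rewrite big_nat_recl // [in RHS]big_nat_recl //= !expn0 !divk_1.
rewrite addrCA; congr (_ + _); rewrite mulr_sumr -big_split /=; apply: eq_bigr => b _.
by rewrite divk_prime_powS // natrD mulrDl exprS invfM mulrCA; congr (_ + _); rewrite mulrCA.
Qed.

(** The partial sums increase, and the recursion combined with [A N <= A N.+1] bounds them, so a
    limit exists; passing to the limit in the recursion identifies it. *)
Lemma divk_series_cvg k :
  (fun N => \sum_(0 <= b < N) term k b) @ \oo --> (1 - x) ^- k.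
Proof.
elim: k => [|k IH].
  rewrite expr0 invr1 -(cvg_shiftn 1) /=; apply: cvg_near_cst; near=> N.
  rewrite addn1 big_nat_recl // expn0 divk_1 expr0 invr1 mulr1 big1 ?addr0 // => i _.
  rewrite divk0 (_ : _ == _ = false) ?mul0r //.
  by apply/negbTE; rewrite -[X in _ != X](expn0 p) eqn_exp2l // prime_gt1.
set A := fun N => \sum_(0 <= b < N) term k.+1 b.
have Aincr : nondecreasing_seq A.
  apply/nondecreasing_seqP => n; rewrite /A big_nat_recr //= lerDl; exact: divk_term_ge0.
have y0 : 0 < 1 - x by rewrite subr_gt0.
have kincr : nondecreasing_seq (fun N => \sum_(0 <= b < N) term k b).
  apply/nondecreasing_seqP => n; rewrite big_nat_recr //= lerDl; exact: divk_term_ge0.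
have Aub N : A N <= (1 - x) ^- k.+1.
  have := divk_series_rec k N; rewrite -/(A N) -/(A N.+1) => E.
  have le1 : A N <= A N.+1 by apply: Aincr.
  have le2 : \sum_(0 <= b < N.+1) term k b <= (1 - x) ^- k.
    have := nondecreasing_cvgn_le kincr (cvgP _ IH) N.+1.
    by rewrite (cvg_lim _ IH).
  rewrite exprSr invfM ler_pdivlMr // mulrC mulrBl mul1r lerBlDr.
  by apply: le_trans le1 _; rewrite E addrC lerD2r; exact: le2.
have Acv : cvgn A.
  by apply: nondecreasing_is_cvgn => //; exists ((1 - x) ^- k.+1) => _ [N _ <-].
have lim1 : (fun N => A N.+1 - x * A N) @ \oo --> (1 - x) * limn A.
  rewrite mulrBl mul1r; apply: cvgB; last by apply: cvgMl_tmp.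
  have := Acv; rewrite -(cvg_shiftS A) => h; apply: h.
have lim2 : (fun N => A N.+1 - x * A N) @ \oo --> (1 - x) ^- k.
  rewrite (_ : (fun N => _) = (fun N => \sum_(0 <= b < N.+1) term k b)).
    by have := IH; rewrite -(cvg_shiftS (fun N => \sum_(0 <= b < N) term k b)).
  by apply/funext => N; rewrite /A divk_series_rec addrAC subrr add0r.
have -> : (1 - x) ^- k.+1 = limn A; last exact: Acv.
have := cvg_unique (@norm_hausdorff _ _) lim1 lim2 => E.
by rewrite exprS invfM -E mulKf // gt_eqF.
Unshelve. all: by end_near. Qed.

Lemma divk_tail_cvg k a :
  (fun N => \sum_(a <= b < N) term k b) @ \oo -->
    \big[+%R/0]_(a <= b <oo) term k b.
Proof.
have h : (fun N => \sum_(a <= b < N) term k b) @ \oo -->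
    (1 - x) ^- k - \sum_(0 <= b < a) term k b.
  have h : (fun N => \sum_(0 <= b < N) term k b - \sum_(0 <= b < a) term k b) @ \oo -->
      (1 - x) ^- k - \sum_(0 <= b < a) term k b.
    exact: cvgB (@divk_series_cvg k) (cvg_cst _).
  apply: cvg_trans h; apply: near_eq_cvg; near=> N => /=.
  have aN : (a <= N)%N by near: N; exists a.
  by rewrite /= (big_cat_nat _ (n := a)) //= addrAC subrr add0r.
by rewrite (cvg_lim _ h).
Unshelve. all: by end_near. Qed.

Lemma divk_tail_ge0 k a : 0 <= \big[+%R/0]_(a <= b <oo) term k b.
Proof.
have h := @divk_tail_cvg k a; rewrite -(cvg_lim _ h) //.
apply: limr_ge; first exact: cvgP h.
by near=> N; apply: sumr_ge0 => b _; exact: divk_term_ge0.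
Unshelve. all: by end_near. Qed.

Lemma divk_series_lim k : \big[+%R/0]_(0 <= b <oo) term k b = (1 - x) ^- k.
Proof. exact: (cvg_unique (@norm_hausdorff _ _) (@divk_tail_cvg k 0) (@divk_series_cvg k)). Qed.

Lemma divk_tail1_lim k : \big[+%R/0]_(1 <= b <oo) term k b = (1 - x) ^- k - 1.
Proof.
have h : (fun N => \sum_(1 <= b < N) term k b) @ \oo --> (1 - x) ^- k - 1.
  have h : (fun N => \sum_(0 <= b < N) term k b - 1) @ \oo --> (1 - x) ^- k - 1.
    exact: cvgB (@divk_series_cvg k) (cvg_cst _).
  apply: cvg_trans h; apply: near_eq_cvg; near=> N => /=.
  have aN : (0 < N)%N by near: N; exists 1%N.
  by rewrite /= big_ltn // expn0 divk_1 expr0 invr1 mulr1 addrAC subrr add0r.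
exact: (cvg_unique (@norm_hausdorff _ _) (@divk_tail_cvg k 1) h).
Unshelve. all: by end_near. Qed.

(* The numerator of the factor of [fkl] at p, with gamma = logn p h. *)
Definition fkl_num k m gamma : R :=
  (1 - x) * (\sum_(0 <= a < gamma.+1) (divk m (p ^ a))%:R *
       \big[+%R/0]_(a <= b <oo) term k b)
  + (divk k (p ^ gamma))%:R * \big[+%R/0]_(gamma.+1 <= a <oo) term m a.

Lemma fkl_num_ge0 k m gamma : 0 <= fkl_num k m gamma.
Proof.
have y0 : 0 <= 1 - x by rewrite subr_ge0 ltW.
rewrite addr_ge0 ?mulr_ge0 ?divk_tail_ge0 // sumr_ge0 // => a _.
by rewrite mulr_ge0 ?divk_tail_ge0.
Qed.

(** At exponent 0 the numerator equals the denominator in [fkl]. Primes not dividing [h] thus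
    contribute a factor 1, and the product can be extended to all primes up to [z]. *)
Lemma fkl_num0 k m : fkl_num k.+1 m 0 = (1 - x) ^- k + (1 - x) ^- m - 1.
Proof.
have y0 : 1 - x != 0 by rewrite subr_eq0 eq_sym lt_eqF.
rewrite /fkl_num big_nat1 !expn0 !divk_1 !mul1r divk_series_lim divk_tail1_lim.
by rewrite exprS invfM mulrA divff // mul1r addrA.
Qed.

Lemma totient_prime_power j : (0 < j)%N -> (totient (p ^ j))%:R = p%:R ^+ j * (1 - x) :> R.
Proof.
case: j => // j _; rewrite totient_pfactor // natrM natrX /= -subn1 natrB ?prime_gt0 //.
have pn0 : p%:R != 0 :> R by rewrite gt_eqF.
by rewrite exprS; field.
Qed.

(** With [g] the exponent of [p] in [h], the gcd condition on [(p^a, p^b)] reads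
    [min(a, b) = min(g, b)]: it means [a >= b] if [b <= g], and [a = g] if [b > g]. These two ranges
    are the two sums in the numerator of [fkl]. In the second one the prefactor [1 - 1/p] is
    cancelled by the totient of [p^(b - g)]. *)
Lemma pair_wt_prime_cvg k m h : (0 < h)%N ->
  (fun N => (1 - x) * \sum_(0 <= b < N) \sum_(0 <= a < N) pair_wt R h k m (p ^ a)%N (p ^ b)%N)
  @ \oo --> fkl_num k m (logn p h).
Proof.
move=> h0; set g := logn p h.
have y0 : 1 - x != 0 by rewrite subr_eq0 eq_sym lt_eqF.
pose A N := (1 - x) * (\sum_(0 <= b < g.+1) (divk m (p ^ b))%:R * \sum_(b <= a < N) term k a)
  + (divk k (p ^ g))%:R * \sum_(g.+1 <= b < N) term m b.
have Acv : A @ \oo --> fkl_num k m g.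
  apply: cvgD; last by apply: cvgMl_tmp; exact: divk_tail_cvg.
  apply: cvgMl_tmp; apply: (@cvg_sumr R R nat nat \oo _ _
    (fun b N => (divk m (p ^ b))%:R * \sum_(b <= a < N) term k a)) => b.
  apply: cvgMl_tmp; exact: divk_tail_cvg.
apply: cvg_trans Acv; apply: near_eq_cvg; near=> N.
have gN : (g < N)%N by near: N; exists g.+1.
have gcdE' a b : gcdn (p ^ a) (p ^ b) = (p ^ minn a b)%N.
  by case: (leqP a b) => ab; [apply/gcdn_idPl|apply/gcdn_idPr]; rewrite dvdn_exp2l // ltnW.
have gcdE b : gcdn h (p ^ b) = (p ^ minn g b)%N.
  rewrite -(partnC p h0) p_part -/g gcdnC Gauss_gcdl; first by rewrite gcdnC gcdE'.
  by apply: (@pnat_coprime p); rewrite ?pnatX ?pnat_id ?part_pnat.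
have wE a b : pair_wt R h k m (p ^ a)%N (p ^ b)%N =
   (minn a b == minn g b)%:R * (divk k (p ^ a))%:R * (divk m (p ^ b))%:R /
     (p%:R ^+ a * (totient (p ^ (b - minn g b)))%:R).
  by rewrite /pair_wt gcdE gcdE' eqn_exp2l ?prime_gt1 // natrX -expnB ?prime_gt0 ?geq_minr.
symmetry; rewrite (big_cat_nat _ (n := g.+1)) //= mulrDr /A; congr (_ + _).
  congr (_ * _); apply: eq_big_nat => b /andP[_ bg]; rewrite ltnS in bg.
  rewrite (big_cat_nat _ (n := b)) //=; last by rewrite (leq_trans bg) // ltnW.
  rewrite [X in X + _]big1_seq ?add0r; last first.
    move=> a; rewrite mem_index_iota /= => ab; rewrite wE (minn_idPl (ltnW ab)) (minn_idPr bg).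
    by rewrite ltn_eqF // !mul0r.
  rewrite mulr_sumr; apply: eq_big_nat => a /andP[ba _].
  rewrite wE (minn_idPr ba) (minn_idPr bg) eqxx subnn expn0 (_ : totient 1 = 1%N) // mulr1 mul1r.
  by rewrite mulrA [X in X / _]mulrC.
rewrite !mulr_sumr; apply: eq_big_nat => b /andP[gb _].
rewrite (bigD1_seq g) ?iota_uniq ?mem_index_iota //= big1_seq ?addr0; last first.
  move=> a /andP[ag _]; rewrite wE (minn_idPl (ltnW gb)) (_ : _ == g = false) ?mul0r //.
  by apply/negbTE; move: ag; rewrite /minn; case: ifP => //; lia.
rewrite wE eqxx (minn_idPl (ltnW gb)) totient_prime_power ?subn_gt0 // mul1r.
have -> : p%:R ^+ b = p%:R ^+ g * p%:R ^+ (b - g) :> R by rewrite -exprD subnKC // ltnW.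
rewrite !invfM -[RHS](mulVKf y0); ring.
Unshelve. all: by end_near. Qed.

End Local.

(** * From single primes to finite sets of primes *)

Section Euler.
Variables (R : realType) (h : nat).
Hypothesis h0 : (0 < h)%N.
Implicit Types (k m a b p M N : nat) (ps : seq nat).

Local Notation G := (pair_wt R h).

(** Splitting [h] as well into its [tau]-part and its complement makes both gcds multiplicative.
    Comparing [tau]-parts and complementary parts then splits the gcd condition into two independent
    ones. *)
Lemma pair_wtM k m (tau : nat_pred) a a' b b' :
  (0 < a)%N -> (0 < a')%N -> (0 < b)%N -> (0 < b')%N ->
  tau.-nat a -> tau.-nat b -> (negn tau).-nat a' -> (negn tau).-nat b' ->
  G k m (a * a')%N (b * b')%N = G k m a b * G k m a' b'.
Proof.
move=> a0 a'0 b0 b'0 ta tb ta' tb'.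
have part1 x y : (0 < x)%N -> (0 < y)%N -> tau.-nat x -> (negn tau).-nat y ->
    partn (x * y) tau = x /\ partn (x * y) (negn tau) = y.
  move=> x0 y0 px py; rewrite !partnM // (part_pnat_id px) (part_p'nat py).
  by rewrite (part_pnat_id py) part_p'nat ?muln1 ?mul1n // pnatNK.
have cop x y : tau.-nat x -> (negn tau).-nat y -> coprime x y by exact: pnat_coprime.
have gcdM x y z t : tau.-nat x -> tau.-nat z -> (negn tau).-nat y -> (negn tau).-nat t ->
    gcdn (x * y) (z * t) = (gcdn x z * gcdn y t)%N.
  move=> tx tz ty tt.
  have c1 : coprime (gcdn (x * y) z) t by apply: coprime_dvdl (dvdn_gcdr _ _) _; exact: cop.
  have c2 : coprime z y by exact: cop.
  apply/eqP; rewrite eqn_dvd; apply/andP; split.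
    rewrite -(gcdn_idPl (dvdn_gcdr _ _) : gcdn (gcdn (x * y) (z * t)) (z * t) = _).
    have -> : gcdn x z = gcdn (x * y) z by rewrite gcdnC -(Gauss_gcdl x c2) gcdnC.
    have -> : gcdn y t = gcdn (x * y) t.
      by rewrite [RHS]gcdnC Gauss_gcdr 1?gcdnC // coprime_sym cop.
    rewrite muln_gcdr dvdn_gcd muln_gcdl [in X in _ && X]muln_gcdl !dvdn_gcd.
    have d1 := dvdn_gcdl (x * y) (z * t); have d2 := dvdn_gcdr (x * y) (z * t).
    set d := gcdn (x * y) (z * t) in d1 d2 *.
    rewrite (gcdn_idPl d2) (dvdn_mulr _ d1) (dvdn_mull _ d1) (dvdn_mulr _ d1) d2.
    by [].
  by rewrite dvdn_gcd !dvdn_mul ?dvdn_gcdl ?dvdn_gcdr.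
have hE : h = (partn h tau * partn h (negn tau))%N by rewrite partnC.
have gh : gcdn h (b * b') = (gcdn h b * gcdn h b')%N.
  rewrite {1}hE gcdM ?part_pnat //; congr (_ * _)%N.
    by rewrite [in RHS]hE ![gcdn _ b]gcdnC Gauss_gcdl // cop // part_pnat.
  by rewrite [in RHS]hE ![gcdn _ b']gcdnC Gauss_gcdr // coprime_sym cop // part_pnat.
have tg x y : (0 < x)%N -> tau.-nat x -> tau.-nat (gcdn y x).
  by move=> x0 tx; apply: pnat_dvd (dvdn_gcdr _ _) tx.
have tg' x y : (0 < x)%N -> (negn tau).-nat x -> (negn tau).-nat (gcdn y x).
  by move=> x0 tx; apply: pnat_dvd (dvdn_gcdr _ _) tx.
have E : (gcdn (a * a') (b * b') == gcdn h (b * b')) = (gcdn a b == gcdn h b) && (gcdn a' b' == gcdn h b').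
  rewrite gcdM // gh; apply/idP/idP => [/eqP e|/andP[/eqP -> /eqP ->] //].
  have gp x y : (0 < x)%N -> (0 < gcdn y x)%N by rewrite gcdn_gt0 orbC => ->.
  have [e1 e1'] := part1 _ _ (gp b a b0) (gp b' a' b'0) (tg b a b0 tb) (tg' b' a' b'0 tb').
  have [e2 e2'] := part1 _ _ (gp b h b0) (gp b' h b'0) (tg b h b0 tb) (tg' b' h b'0 tb').
  by apply/andP; split; apply/eqP; [rewrite -e1 e e2|rewrite -e1' e e2'].
have tot : totient (b * b' %/ gcdn h (b * b')) =
    (totient (b %/ gcdn h b) * totient (b' %/ gcdn h b'))%N.
  have dd x y : (y %| x)%N -> (x %/ y %| x)%N.
    by move=> yx; apply/dvdnP; exists y; rewrite mulnC divnK.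
  rewrite -totient_coprime; last first.
    exact: cop (pnat_dvd (dd _ _ (dvdn_gcdr h b)) tb) (pnat_dvd (dd _ _ (dvdn_gcdr h b')) tb').
  rewrite gh -{1}(divnK (dvdn_gcdr h b)) -{1}(divnK (dvdn_gcdr h b')) mulnACA mulnK //.
  by rewrite muln_gt0 !gcdn_gt0 h0.
rewrite /pair_wt E tot !divkM ?cop // -mulnb !natrM !invfM; ring.
Qed.

Lemma pair_wt_ge0 k m a b : 0 <= G k m a b.
Proof. by rewrite /pair_wt !mulr_ge0 // invr_ge0 mulr_ge0. Qed.

Local Notation inps ps := ([pred q : nat | q \in ps] : nat_pred).

Lemma ler_sum_subseq (I : eqType) (s t : seq I) (F : I -> R) :
  uniq s -> uniq t -> {subset s <= t} -> (forall i, 0 <= F i) ->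
  \sum_(i <- s) F i <= \sum_(i <- t) F i.
Proof.
move=> us ut st F0; rewrite [leRHS](bigID (fun i => i \in s)) /= -[X in _ <= X + _]big_filter.
have ps : perm_eq [seq i <- t | i \in s] s.
  apply: uniq_perm => //; first exact: filter_uniq.
  by move=> i; rewrite mem_filter /=; case: (boolP (i \in s)) => //= /st ->.
by rewrite (perm_big s ps) /= lerDl sumr_ge0.
Qed.

(** The map [(j, b) -> p^j b] is injective: [j] is recovered as the [p]-adic valuation since [p]
    does not divide [b]. Its values are at most [p ^ N * M], so the sum on the right reaches them
    all. *)
Lemma prime_split_ge p ps M N (F : nat -> R) : prime p -> p \notin ps ->
  (forall n, 0 <= F n) ->
  \sum_(0 <= j < N) \sum_(1 <= b < M | (inps ps).-nat b) F (p ^ j * b)%N <=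
  \sum_(1 <= n < (p ^ N * M).+1 | (inps (p :: ps)).-nat n) F n.
Proof.
move=> pp pps F0.
rewrite (eq_bigr (fun j => \sum_(b <- [seq b <- index_iota 1 M | (inps ps).-nat b]) F (p ^ j * b)%N)); last first.
  by move=> j _; rewrite big_filter.
rewrite -(big_allpairs_dep (h := fun j b => (p ^ j * b)%N) (F := F)) -[leRHS]big_filter.
have lg j b : (inps ps).-nat b -> logn p (p ^ j * b)%N = j.
  move=> pb; have b0 : (0 < b)%N by case/andP: pb.
  rewrite lognM ?expn_gt0 ?(prime_gt0 pp) // pfactorK // logn_coprime ?addn0 // prime_coprime //.
  apply/negP => pdb; have : p \in \pi(b) by rewrite mem_primes pp b0 pdb.
  by move=> /(pnatPpi pb); rewrite inE (negbTE pps).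
apply: ler_sum_subseq => //.
- apply: allpairs_uniq; rewrite ?filter_uniq ?iota_uniq //.
  move=> [j b] [j' b'] /allpairsP[[j1 b1] /= [_ + [-> ->]]] /allpairsP[[j2 b2] /= [_ + [-> ->]]].
  rewrite !mem_filter => /andP[pb1 _] /andP[pb2 _] /= e.
  have ej : j1 = j2 by rewrite -(lg j1 b1 pb1) e lg.
  move: e; rewrite ej => /eqP; rewrite eqn_pmul2l ?expn_gt0 ?prime_gt0 //.
  by move=> /eqP ->.
- by rewrite filter_uniq // iota_uniq.
move=> n /allpairsP[[j b] /= []]; rewrite mem_index_iota mem_filter mem_index_iota.
move=> /= jN /andP[pb /andP[b0 bM]] ->; rewrite mem_filter mem_index_iota.
apply/and3P; split.
- rewrite pnatM; apply/andP; split.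
    by rewrite pnatX pnatE // !inE eqxx.
  by apply: sub_in_pnat pb => q _; rewrite !inE => ->; rewrite orbT.
- by rewrite muln_gt0 expn_gt0 prime_gt0.
- rewrite ltnS; apply: leq_mul; last exact: ltnW.
  rewrite leq_exp2l; [exact: ltnW | exact: prime_gt1].
Qed.

Lemma euler_finite_ge k m ps N : uniq ps -> all prime ps ->
  exists M, \prod_(p <- ps) (\sum_(0 <= b < N) \sum_(0 <= a < N) G k m (p ^ a)%N (p ^ b)%N) <=
   \sum_(1 <= b < M | (inps ps).-nat b) \sum_(1 <= a < M | (inps ps).-nat a) G k m a b.
Proof.
elim: ps => [_ _|p ps IH /= /andP[pps ups] /andP[pp aps]].
  (* Without primes only [a = b = 1] occurs, and its weight equals the empty product 1. *)
  exists 2%N; have n1 : (inps [::]).-nat 1%N by [].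
  rewrite big_nil big_mkcond /= big_nat1 n1 big_mkcond /= big_nat1 n1.
  by rewrite /pair_wt !gcdn1 !divk_1 divn1 eqxx mul1r mulr1 divr1.
have [M HM] := IH ups aps; exists (p ^ N * M).+1.
rewrite big_cons.
apply: (@le_trans _ _ (\sum_(0 <= j < N) \sum_(1 <= b < M | (inps ps).-nat b)
   \sum_(0 <= i < N) \sum_(1 <= a < M | (inps ps).-nat a) G k m (p ^ i * a)%N (p ^ j * b)%N)); last first.
  apply: le_trans (prime_split_ge M N (F := fun b => \sum_(1 <= a < (p ^ N * M).+1 | (inps (p :: ps)).-nat a) G k m a b) pp pps _); last first.
    by move=> b; apply: sumr_ge0 => a _; exact: pair_wt_ge0.
  apply: ler_sum => j _; apply: ler_sum => b _.
  by apply: (prime_split_ge M N (F := fun a => G k m a (p ^ j * b)%N)) => // a; exact: pair_wt_ge0.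
apply: le_trans (ler_wpM2l _ HM) _.
  by do 2![apply: sumr_ge0 => ? _]; exact: pair_wt_ge0.
rewrite mulr_suml; apply: ler_sum => j _.
rewrite mulr_sumr [leLHS]big_nat_cond [leRHS]big_nat_cond.
apply: ler_sum => b /andP[/andP[b0 _] pb].
rewrite mulr_suml; apply: ler_sum => i _.
rewrite mulr_sumr [leLHS]big_nat_cond [leRHS]big_nat_cond.
apply: ler_sum => a /andP[/andP[a0 _] pa].
have pX e : (p : nat_pred).-nat (p ^ e)%N by rewrite pnatX pnat_id.
have np c : (inps ps).-nat c -> (negn p).-nat c.
  apply: sub_in_pnat => q _; rewrite !inE => qps.
  by apply: contraNneq pps => <-.
by rewrite (pair_wtM k m (tau := p)) ?expn_gt0 ?(prime_gt0 pp) ?np ?pX // lexx.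
Qed.

End Euler.

(** * Comparison of the Euler product with [Ckl] and [fkl] *)

Section Const.
Variable R : realType.
Implicit Types (k m h z p M N : nat).

Lemma prime_dvd_fact p z : prime p -> (p %| z`!)%N = (p <= z)%N.
Proof.
move=> pp; apply/idP/idP => [|pz]; last by rewrite dvdn_fact // prime_gt0.
elim: z => [|z IH]; first by rewrite fact0 dvdn1 => /eqP E; rewrite E in pp.
rewrite factS Euclid_dvdM // => /orP[/dvdn_leq -> //|/IH]; exact: leqW.
Qed.

Definition Ckl_factor k m p : R :=
  (1 - p%:R^-1) ^+ m + (1 - p%:R^-1) ^+ k - (1 - p%:R^-1) ^+ (k + m).

Lemma prime_inv_itv p : prime p -> 0 < 1 - p%:R^-1 :> R /\ 1 - p%:R^-1 <= 1 :> R.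
Proof.
move=> pp; split; last by rewrite gerDl oppr_le0 invr_ge0.
by rewrite subr_gt0 invf_lt1 ?ltr0n ?prime_gt0 // ltr1n prime_gt1.
Qed.

(** With [u] and [v] the two powers, both in [[0, 1]], the factor is [1 - (1 - u) (1 - v)]. *)
Lemma Ckl_factor_itv k m p : prime p -> 0 <= Ckl_factor k m p <= 1.
Proof.
move=> /prime_inv_itv[y0 y1]; rewrite /Ckl_factor exprD.
set u := _ ^+ m; set v := _ ^+ k.
have u0 : 0 <= u by rewrite exprn_ge0 // ltW.
have v0 : 0 <= v by rewrite exprn_ge0 // ltW.
have u1 : u <= 1 by rewrite exprn_ile1 // ltW.
have v1 : v <= 1 by rewrite exprn_ile1 // ltW.
by apply/andP; split; nra.
Qed.

(** The second factor is the denominator in [fkl]; in the product of the two constants it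
    cancels. *)
Lemma Ckl_factorE k m p : prime p ->
  Ckl_factor k m p = (1 - p%:R^-1) ^+ (k + m) *
    ((1 - p%:R^-1) ^- k + (1 - p%:R^-1) ^- m - 1).
Proof.
move=> /prime_inv_itv[y0 _]; rewrite /Ckl_factor exprD.
have u0 : (1 - p%:R^-1) ^+ k != 0 :> R by rewrite expf_neq0 // gt_eqF.
have v0 : (1 - p%:R^-1) ^+ m != 0 :> R by rewrite expf_neq0 // gt_eqF.
by rewrite mulrBr mulr1 mulrDr mulrAC divff // mul1r -mulrA divff // mulr1.
Qed.

Lemma Ckl_le k m z : Ckl R k.+1 m.+1 <= \prod_(p <- primes z`!) Ckl_factor k m p.
Proof.
pose u n : R := \prod_(0 <= p < n | prime p) Ckl_factor k m p.
have -> : Ckl R k.+1 m.+1 = limn u.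
  rewrite /Ckl; congr (limn _); apply/funext => n; apply: eq_bigr => p _.
  by rewrite /Ckl_factor !subn1 (_ : k.+1 + m.+1 - 2 = k + m)%N //; lia.
have udec : nonincreasing_seq u.
  apply/nonincreasing_seqP => n; rewrite /u big_mkcond [leRHS]big_mkcond big_nat_recr //=.
  case: ifP => [pp|_]; last by rewrite mulr1.
  have /andP[c0 c1] := Ckl_factor_itv k m pp; rewrite ler_piMr //.
  by apply: prodr_ge0 => q _; case: ifP => // qq; have /andP[] := Ckl_factor_itv k m qq.
have u0 n : 0 <= u n by apply: prodr_ge0 => q qq; have /andP[] := Ckl_factor_itv k m qq.
have ucv : cvgn u.
  by apply: nonincreasing_is_cvgn => //; exists 0 => _ [n _ <-]; exact: u0.
apply: le_trans (nonincreasing_cvgn_ge udec ucv z.+1) _.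
rewrite /u -big_filter (perm_big (primes z`!)) //.
apply: uniq_perm; rewrite ?filter_uniq ?iota_uniq ?primes_uniq // => p.
rewrite mem_filter mem_index_iota mem_primes fact_gt0 /= ltnS.
by case: (boolP (prime p)) => //= pp; rewrite prime_dvd_fact.
Qed.

Lemma fkl_le k m h z : (0 < h)%N -> (h <= z)%N ->
  0 <= fkl R k.+1 m.+1 h /\
  \prod_(p <- primes z`!) Ckl_factor k m p * fkl R k.+1 m.+1 h =
  \prod_(p <- primes z`!) ((1 - p%:R^-1) ^+ (k + m) * fkl_num R p k.+1 m (logn p h)).
Proof.
move=> h0 hz.
pose f p : R := fkl_num R p k.+1 m (logn p h) / ((1 - p%:R^-1) ^- k + (1 - p%:R^-1) ^- m - 1).
have den p : prime p -> 0 < (1 - p%:R^-1) ^- k + (1 - p%:R^-1) ^- m - 1 :> R.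
  move=> /prime_inv_itv[y0 y1].
  have ge1 j : 1 <= (1 - p%:R^-1) ^- j :> R by rewrite invf_ge1 ?exprn_gt0 // exprn_ile1 // ltW.
  by have := ge1 k; have := ge1 m; lra.
have -> : fkl R k.+1 m.+1 h = \prod_(p <- primes h) f p.
  rewrite /fkl /f /fkl_num; apply: eq_bigr => p _; by rewrite !subn1.
split.
  rewrite big_seq; apply: prodr_ge0 => p; rewrite mem_primes => /and3P[pp _ _].
  by rewrite divr_ge0 ?fkl_num_ge0 // ltW // den.
have -> : \prod_(p <- primes h) f p = \prod_(p <- primes z`!) f p.
  rewrite [RHS](bigID (fun p => p \in primes h)) /= [X in _ * X]big1_seq ?mulr1; last first.
    move=> p /andP[ph]; rewrite mem_primes => /and3P[pp _ _]; rewrite /f.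
    have -> : logn p h = 0%N.
      by move: ph; rewrite mem_primes pp h0 /= => ph; rewrite lognE pp h0 (negbTE ph).
    by rewrite fkl_num0 // divff // gt_eqF // den.
  rewrite -[RHS]big_filter; apply: perm_big; apply: uniq_perm; rewrite ?filter_uniq ?primes_uniq // => p.
  rewrite mem_filter; case: (boolP (p \in primes h)) => //=.
  rewrite !mem_primes fact_gt0 => /and3P[pp _ ph]; rewrite pp prime_dvd_fact //=.
  by symmetry; apply: leq_trans hz; rewrite dvdn_leq.
rewrite -big_split /= big_seq [RHS]big_seq; apply: eq_bigr => p.
rewrite mem_primes => /and3P[pp _ _]; rewrite Ckl_factorE // /f -mulrA; congr (_ * _).
by rewrite mulrC divfK // gt_eqF // den.
Qed.

(** Of the [k + 1 + m] powers of [1 - 1/p] in [tdens], one goes into the local limit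
    [pair_wt_prime_cvg] and [k + m] are those of [Ckl_factorE]. The slack [kap] pays for cutting
    prime exponents at [N]; the bound [h <= z] ensures that every prime of [h] occurs. *)
Lemma euler_limit k m h z (kap : R) : (0 < h)%N -> (h <= z)%N -> 0 < kap ->
  exists M, Ckl R k.+1 m.+1 * fkl R k.+1 m.+1 h - kap <=
    tdens R z`! ^+ (k.+1 + m) *
    \sum_(1 <= b < M | (\pi(z`!)).-nat b) \sum_(1 <= a < M | (\pi(z`!)).-nat a)
      pair_wt R h k.+1 m a b.
Proof.
move=> h0 hz kap0; have [f0 Ef] := fkl_le k m h0 hz.
have le1 := ler_wpM2r f0 (Ckl_le k m z); rewrite Ef in le1.
set L := \prod_(p <- primes z`!) _ in le1.
pose S p N : R := \sum_(0 <= b < N) \sum_(0 <= a < N) pair_wt R h k.+1 m (p ^ a)%N (p ^ b)%N.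
(* [cvg_prodr] asks for convergence at every index, not just at those in the list, hence the default
   value 0 off the primes. *)
pose U N : R := \prod_(p <- primes z`!) (if prime p then (1 - p%:R^-1) ^+ (k + m) * ((1 - p%:R^-1) * S p N) else 0).
have UL : U @ \oo --> L.
  rewrite (_ : L = \prod_(p <- primes z`!) (if prime p then (1 - p%:R^-1) ^+ (k + m) * fkl_num R p k.+1 m (logn p h) else 0)).
    apply: cvg_prodr => p; case: (boolP (prime p)) => [pp|_]; last exact: cvg_cst.
    apply: cvgMl_tmp; exact: pair_wt_prime_cvg.
  rewrite /L big_seq [RHS]big_seq; apply: eq_bigr => p.
  by rewrite mem_primes => /and3P[-> _ _].
have [N HN] : exists N, L - kap <= U N.
  have /cvgrPdist_le/(_ _ kap0)[N _ HN] := UL.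
  exists N; have := HN N (leqnn N); rewrite ler_distlC => /andP[].
  by rewrite lerBlDr.
have ap : all prime (primes z`!) by apply/allP => p; rewrite mem_primes => /and3P[].
have [M HM] := @euler_finite_ge R h h0 k.+1 m _ N (primes_uniq _) ap.
exists M; apply: le_trans (lerB le1 (lexx kap)) (le_trans HN _).
have -> : U N = tdens R z`! ^+ (k.+1 + m) * \prod_(p <- primes z`!) S p N.
  rewrite /tdens tdensE ?fact_gt0 // -prodrXl -big_split /= /U big_seq [RHS]big_seq.
  apply: eq_bigr => p; rewrite mem_primes => /and3P[-> _ _].
  by rewrite addSn exprSr mulrA.
by apply: ler_wpM2l => //; rewrite exprn_ge0 // divr_ge0.
Qed.

(* Polynomial decay of prod_(p <= z) (1 - 1/p) with exponent below 1 is what beats the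
   tail sum_(p > z) 1/p^2 = O(1/z): odd factors are bounded by (1 - 1/j)^2 >= (j - 2)/j,
   whose product telescopes. *)
Lemma tdens_fact_sqr t : (4 * t.*2.+1%:R)^-1 <= tdens R (t.*2.+1)`! ^+ 2.
Proof.
pose g n : R := \prod_(1 <= p < n.+1 | prime p) (1 - p%:R^-1).
have gE n : tdens R n`! = g n.
  rewrite /tdens tdensE ?fact_gt0 // /g -[RHS]big_filter; apply: perm_big.
  apply: uniq_perm; rewrite ?filter_uniq ?iota_uniq ?primes_uniq // => p.
  rewrite mem_filter mem_index_iota mem_primes fact_gt0 /= ltnS.
  by case: (boolP (prime p)) => //= pp; rewrite prime_dvd_fact // prime_gt0.
have gS n : g n.+1 = g n * (if prime n.+1 then 1 - n.+1%:R^-1 else 1).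
  by rewrite /g big_mkcond [in RHS]big_mkcond big_nat_recr.
have g1 : g 1%N = 1 by rewrite /g big_mkcond big_nat1.
rewrite gE; elim: t => [|t IH].
  by rewrite double0 g1 expr1n invf_le1 ?mulr1 // ler1n.
rewrite doubleS gS gS; set c := t.*2.+1 in IH *.
have c0 : 0 < c%:R :> R by rewrite ltr0n.
case: (posnP t) => [t0|t0].
  (* Going from 1 to 3 meets the only even prime: the product becomes [1/2 * 2/3], with square
     [1/9 >= 1/12]. The constant 4 makes room for this step. *)
  by have -> : c = 1%N by [rewrite /c t0]; rewrite g1 /=; lra.
have -> : prime c.+1 = false.
  apply/negP => pc; have [E|] := even_prime pc; last by rewrite /c /= negbK odd_double.
  by rewrite /c in E; lia.
rewrite mulr1 exprMn.
apply: (@le_trans _ _ ((4 * c%:R)^-1 * (1 - c.+2%:R^-1) ^+ 2)).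
  have -> : (4 * c.+2%:R)^-1 = (4 * c%:R)^-1 * (c%:R / c.+2%:R) :> R.
    by field; rewrite !gt_eqF.
  apply: ler_wpM2l; first by rewrite invr_ge0 mulr_ge0.
  rewrite -subr_ge0.
  have -> : (1 - c.+2%:R^-1) ^+ 2 - c%:R / c.+2%:R = (c.+2%:R ^+ 2)^-1 :> R.
    by rewrite -natr1 -natr1; field; rewrite !natr1.
  by rewrite invr_ge0 exprn_ge0.
apply: ler_pM; rewrite ?sqr_ge0 ?invr_ge0 // ?mulr_ge0 //.
case: (prime _) => //; rewrite expr1n exprn_ile1 //.
  by rewrite subr_ge0 invf_le1 // ler1n.
Qed.

End Const.

(** * Equidistribution in residue classes *)

Section Equidistribution.
Variable R : realType.
Implicit Types (k m q g h X Y : nat).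

Definition class_sum k X q a : nat :=
  (\sum_(1 <= n < X.+1 | n == a %[mod q]) divk k n)%N.

Lemma count_gcd q g : (0 < q)%N -> (g %| q)%N ->
  (\sum_(0 <= a < q) (gcdn a q == g) = totient (q %/ g))%N.
Proof.
move=> q0 gq; have g0 := dvdn_gt0 q0 gq.
rewrite totient_count_coprime.
have -> : (\sum_(0 <= d < q %/ g) coprime (q %/ g) d =
    \sum_(d <- [seq (d * g)%N | d <- [seq d <- index_iota 0 (q %/ g) | coprime (q %/ g) d]]) 1)%N.
  by rewrite big_map big_filter [RHS]big_mkcond; apply: eq_bigr => d _; case: coprime.
have -> : (\sum_(0 <= a < q) (gcdn a q == g) =
    \sum_(a <- [seq a <- index_iota 0 q | gcdn a q == g]) 1)%N.
  by rewrite big_filter [RHS]big_mkcond; apply: eq_bigr => d _; case: eqP.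
apply: perm_big; apply: uniq_perm.
- by rewrite filter_uniq // iota_uniq.
- by rewrite map_inj_uniq ?filter_uniq ?iota_uniq // => x y /eqP; rewrite eqn_pmul2r // => /eqP.
have E c : (gcdn (c * g) q == g) = coprime (q %/ g) c.
  by rewrite -{1}(divnK gq) -muln_gcdl -[X in _ == X]mul1n eqn_pmul2r // coprime_sym.
move=> a; rewrite mem_filter mem_index_iota; apply/idP/mapP => [/andP[/eqP ga aq]|[c]].
  have /dvdnP[c Ec] : (g %| a)%N by rewrite -ga dvdn_gcdl.
  exists c => //; rewrite mem_filter mem_index_iota -E -Ec ga eqxx /=.
  by move: aq => /=; rewrite Ec -{1}(divnK gq) ltn_pmul2r.
rewrite mem_filter mem_index_iota -E => /andP[/eqP gc /= cq] ->.
by rewrite gc eqxx /= -{1}(divnK gq) ltn_pmul2r.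
Qed.

Lemma gcd_sum_classes k X q g : (0 < q)%N ->
  (\sum_(1 <= n < X.+1 | gcdn n q == g) divk k n =
   \sum_(0 <= a < q | gcdn a q == g) class_sum k X q a)%N.
Proof.
move=> q0; rewrite /class_sum (exchange_big_dep xpredT) //= big_mkcond; apply: eq_bigr => n _.
rewrite big_mkcond (bigD1_seq (n %% q)%N) ?iota_uniq ?mem_index_iota ?ltn_pmod //=.
rewrite gcdn_modl modn_mod eqxx andbT big1_seq ?addn0 // => a /andP[an].
rewrite mem_index_iota => /andP[_ aq]; rewrite (modn_small aq) (eq_sym (n %% q)%N) (negbTE an) andbF //.
Qed.

Lemma dirichlet_continuation_unique k q g (D1 D2 : R[i] -> R[i]) :
  is_dirichlet_continuation k q g D1 -> is_dirichlet_continuation k q g D2 ->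
  \forall s \near (1 : R[i]^o), 1 < complex.Re s -> D1 s = D2 s.
Proof.
move=> [_ H1] [_ H2]; near=> s => s1.
have c1 : 1 < complex.Re s -> _ := near H1 s _.
have c2 : 1 < complex.Re s -> _ := near H2 s _.
exact: (cvg_unique (@norm_hausdorff _ _) (c1 _ s1) (c2 _ s1)).
Unshelve. all: by end_near. Qed.

(* The classes a and b have the same main term by uniqueness of the residue. *)
Lemma class_sum_close k q g a b (theta eps delta K x : R) :
  (forall (x : R) (q a : nat), 1 <= x -> (0 < q)%N ->
    q%:R <= x `^ (theta - eps) -> ~~ (q %| a)%N -> gcdn a q = g ->
   exists (D : R[i] -> R[i]) (r : R[i]),
    [/\ is_dirichlet_continuation k q g D,
        is_residue (fun s => cpow x s / s * D s) 1 r
      & `| (\sum_(1 <= n < (Num.truncn x).+1 | n == a %[mod q]) divk k n)%N%:R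
           - r / (totient (q %/ g))%:R |
        <= (K * (x `^ (1 - delta) / (totient (q %/ g))%:R))%:C%C]) ->
  1 <= x -> (0 < q)%N -> q%:R <= x `^ (theta - eps) ->
  ~~ (q %| a)%N -> gcdn a q = g -> ~~ (q %| b)%N -> gcdn b q = g ->
  (class_sum k (Num.truncn x) q a)%:R <= (class_sum k (Num.truncn x) q b)%:R
    + 2 * (K * (x `^ (1 - delta) / (totient (q %/ g))%:R)) :> R.
Proof.
move=> H x1 q0 qx qa ga qb gb.
have [D1 [r1 [c1 res1 le1]]] := H x q a x1 q0 qx qa ga.
have [D2 [r2 [c2 res2 le2]]] := H x q b x1 q0 qx qb gb.
have r12 : r1 = r2.
  apply: is_residue_unique res1 res2.
  have := dirichlet_continuation_unique c1 c2.
  by apply: filterS => s e /e ->.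
rewrite -/(class_sum k _ q a) in le1; rewrite -/(class_sum k _ q b) in le2.
rewrite -r12 distrC in le2.
set E := K * _ in le1 le2 *.
have := le_trans (ler_normD _ _) (lerD le1 le2).
rewrite addrA subrK => le3.
have le4 : `|((class_sum k (Num.truncn x) q a)%:R - (class_sum k (Num.truncn x) q b)%:R)%:C%C| <= (E + E)%:C%C.
  by rewrite (rmorphD (real_complex R) E E) (rmorphB (real_complex R)) !(rmorph_nat (real_complex R)).
move: le4; rewrite normc_def /= expr0n addr0 sqrtr_sqr lecR => le4.
by rewrite -lerBlDl (le_trans (ler_norm _)) // (le_trans le4) // mulrDl !mul1r.
Qed.

End Equidistribution.

Section Equidistribution2.
Variable R : realType.
Implicit Types (k m q g h X Y : nat).

(** Summing the comparison with the class of [h] over all [phi(q/g)] classes of gcd [g] cancels the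
    [phi(q/g)] in the error. If [q] divides [h], the class is excluded from the distribution
    hypothesis; but then [g = q], and the gcd condition itself describes that class. *)
Lemma equidistribution_gcd k g (theta eps : R) : 0 < eps ->
  exponent_of_distribution k g theta ->
  exists delta K : R, [/\ 0 < delta, 0 <= K & forall x q h, 1 <= x -> (0 < q)%N ->
    q%:R <= x `^ (theta - eps) -> gcdn h q = g ->
    (\sum_(1 <= n < (Num.truncn x).+1 | gcdn n q == g) divk k n)%N%:R - K * x `^ (1 - delta)
    <= (totient (q %/ g))%:R * (class_sum k (Num.truncn x) q h)%:R].
Proof.
move=> e0 /(_ eps e0)[delta d0 [K HK]].
(* The factor 2 comes from comparing two classes through their common main term; the absolute value
   is there because nothing fixes the sign of [K]. *)
exists delta, (2 * `|K|); split => //.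
move=> x q h x1 q0 qx gh; set X := Num.truncn x.
have gq : (g %| q)%N by rewrite -gh dvdn_gcdr.
have err0 : 0 <= 2 * `|K| * x `^ (1 - delta) by rewrite !mulr_ge0 // powR_ge0.
case: (boolP (q %| h)%N) => [qh|qh].
  have gE : g = q by rewrite -gh; apply/gcdn_idPr.
  rewrite gE divnn q0 (_ : totient 1 = 1%N) // mul1r lerBlDr.
  rewrite (_ : (\sum_(1 <= n < X.+1 | gcdn n q == q) divk k n)%N = class_sum k X q h) ?lerDl //.
  apply: eq_bigl => n; move: qh; rewrite /dvdn => /eqP ->.
  by apply/eqP/idP => [/gcdn_idPr|/gcdn_idPr].
have tot0 : (0 < totient (q %/ g))%N.
  by rewrite totient_gt0 divn_gt0 ?(dvdn_gt0 q0 gq) // dvdn_leq.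
have tR : 0 < (totient (q %/ g)%N)%:R :> R by rewrite ltr0n.
have cl a : gcdn a q = g -> (class_sum k X q a)%:R <= (class_sum k X q h)%:R
    + 2 * (`|K| * (x `^ (1 - delta) / (totient (q %/ g))%:R)) :> R.
  move=> ga; have qa : ~~ (q %| a)%N.
    apply: contra qh => qa; have qg : q = g by rewrite -ga; symmetry; apply/gcdn_idPr.
    by rewrite {1}qg -gh dvdn_gcdl.
  apply: le_trans (class_sum_close HK x1 q0 qx qa ga qh gh) _.
  by rewrite lerD2l ler_wpM2l // ler_wpM2r ?ler_norm // divr_ge0 // powR_ge0.
rewrite (gcd_sum_classes k X g q0) natr_sum lerBlDr.
apply: (@le_trans _ _ (\sum_(0 <= a < q | gcdn a q == g) ((class_sum k X q h)%:R
    + 2 * (`|K| * (x `^ (1 - delta) / (totient (q %/ g))%:R))))).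
  by apply: ler_sum => a /eqP; exact: cl.
rewrite big_mkcond /= (eq_bigr (fun a => (gcdn a q == g)%:R * ((class_sum k X q h)%:R
    + 2 * (`|K| * (x `^ (1 - delta) / (totient (q %/ g))%:R))))); last first.
  by move=> a _; rewrite [RHS]mulr_natl mulrb.
rewrite -mulr_suml -natr_sum count_gcd // mulrDr lerD2l.
by rewrite le_eqVlt; apply/orP; left; apply/eqP; field; rewrite gt_eqF.
Qed.

(** The constants depend on the gcd, but [gcd(h, q)] takes at most [h] values. The induction runs
    over an upper bound for the gcd, keeping the smaller [delta] and the larger [K]. *)
Lemma equidistribution k h (theta eps : R) : (0 < h)%N -> 0 < eps ->
  (forall g, (0 < g)%N -> exponent_of_distribution k g theta) ->
  exists delta K : R, [/\ 0 < delta, 0 <= K & forall x q, 1 <= x -> (0 < q)%N ->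
    q%:R <= x `^ (theta - eps) ->
    (\sum_(1 <= n < (Num.truncn x).+1 | gcdn n q == gcdn h q) divk k n)%N%:R - K * x `^ (1 - delta)
    <= (totient (q %/ gcdn h q))%:R * (class_sum k (Num.truncn x) q h)%:R].
Proof.
move=> h0 e0 H.
have [delta [K [d0 K0 HK]]] : exists delta K : R, [/\ 0 < delta, 0 <= K & forall x q, 1 <= x -> (0 < q)%N ->
    (gcdn h q <= h)%N -> q%:R <= x `^ (theta - eps) ->
    (\sum_(1 <= n < (Num.truncn x).+1 | gcdn n q == gcdn h q) divk k n)%N%:R - K * x `^ (1 - delta)
    <= (totient (q %/ gcdn h q))%:R * (class_sum k (Num.truncn x) q h)%:R].
  elim: {2}h => [|G [d1 [K1 [d10 K10 H1]]]].
    exists 1, 0; split => // x q _ _; by rewrite leqn0 gtn_eqF // gcdn_gt0 h0.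
  have [d2 [K2 [d20 K20 H2]]] := equidistribution_gcd e0 (H G.+1 isT).
  exists (Num.min d1 d2), (Num.max K1 K2); split.
  - by rewrite lt_min d10.
  - by rewrite le_max K10.
  move=> x q x1 q0 gG qx.
  have mono d K : Num.min d1 d2 <= d -> 0 <= K -> K <= Num.max K1 K2 ->
      K * x `^ (1 - d) <= Num.max K1 K2 * x `^ (1 - Num.min d1 d2).
    move=> dd K0' KK; apply: ler_pM => //; first exact: powR_ge0.
    by apply: ler_powR => //; rewrite lerD2l lerN2.
  move: gG; rewrite leq_eqVlt => /orP[/eqP gE|gG].
    have := H2 x q h x1 q0 qx gE; rewrite -gE; apply: le_trans.
    by rewrite lerD2l lerN2 mono // ?ge_min ?le_max lexx orbT.
  apply: le_trans (H1 x q x1 q0 gG qx).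
  by rewrite lerD2l lerN2 mono // ?ge_min ?le_max lexx.
exists delta, K; split => // x q x1 q0 qx; apply: HK => //.
by rewrite dvdn_leq // dvdn_gcdl.
Qed.

(** Members of the class above [h] are [h] plus a positive multiple of [q]; those up to [h] are not
    of this form and are bounded by a constant. Enlarging the range to [X + h] lets the multiples
    run up to [X]. *)
Lemma class_sum_le k X q h : (0 < q)%N ->
  (class_sum k X q h <= \sum_(1 <= n < h.+1) divk k n
     + \sum_(1 <= a < (X %/ q).+1) divk k (a * q + h))%N.
Proof.
move=> q0; rewrite /class_sum.
apply: (@leq_trans (\sum_(1 <= n < (X + h).+1 | n == h %[mod q]) divk k n)%N).
  rewrite [leqRHS](big_cat_nat _ (n := X.+1)) //= ?ltnS ?leq_addr //.
rewrite (big_cat_nat _ (n := h.+1)) //=; last by rewrite ltnS leq_addl.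
apply: leq_add.
  by rewrite big_mkcond; apply: leq_sum => n _; case: ifP.
rewrite -{1}[h.+1]add1n big_addn subSn ?leq_addl // addnK.
have E := @sum_multiples nat q X (fun a => divk k (a + h)) q0.
rewrite (eq_bigl (fun n => q %| n)%N); first by rewrite E.
by move=> n; rewrite -{2}[h]add0n eqn_modDr mod0n.
Qed.

Lemma shifted_sum_ge k m h X Y : (Y <= X)%N ->
  \sum_(1 <= q < Y.+1) (divk m q)%:R * ((class_sum k X q h)%:R - (\sum_(1 <= n < h.+1) divk k n)%N%:R) <=
  (\sum_(1 <= n < X.+1) divk k (n + h) * divk m.+1 n)%N%:R :> R.
Proof.
move=> YX; rewrite [leRHS]natr_sum.
under [leRHS]eq_bigr do rewrite natrM mulrC.
rewrite (sum_divkS m X (fun n => (divk k (n + h))%:R : R)).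
apply: (@le_trans _ _ (\sum_(1 <= q < Y.+1) (divk m q)%:R *
   \sum_(1 <= a < (X %/ q).+1) (divk k (a * q + h))%:R)).
  apply: ler_sum_nat => q /andP[q0 _]; apply: ler_wpM2l => //.
  by rewrite lerBlDr -natr_sum -natrD ler_nat addnC class_sum_le.
by apply: ler_sum_nat_widen => // q; rewrite mulr_ge0 // sumr_ge0.
Qed.

End Equidistribution2.

(** * The lower bound *)

Section LowerBound.
Variable R : realType.
Implicit Types (k m q h z M X Y : nat).

Definition pair_sum Q h k m M : R :=
  \sum_(1 <= b < M | (\pi(Q)).-nat b) \sum_(1 <= a < M | (\pi(Q)).-nat a)
    pair_wt R h k m a b.

(** Replacing [a] and [b] by [M + 1] inside the logarithms makes the bound independent of the pair,
    so that it can be pulled out of the sum over [(a, b)]; the price is a constant added to each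
    logarithm. *)
Lemma rough_product_ge Q k m M a b (x eps eta : R) : (1 < Q)%N ->
  0 < eps -> eps <= 1 -> 1 <= x -> (0 < a < M)%N -> (0 < b < M)%N ->
  M.+1%:R * Q%:R ^+ k.+1 <= eps * x -> M.+1%:R * Q%:R ^+ m <= x `^ eta ->
  (1 - eps) * tdens R Q ^+ (k.+1 + m) / (k`!%:R * m`!%:R) * x *
    (ln x + ln (eps / (M.+1%:R * Q%:R ^+ k.+1))) ^+ k *
    (eta * ln x + - ln (M.+1%:R * Q%:R ^+ m)) ^+ m <=
  a%:R * rough_dsum R Q k.+1 (Num.truncn x %/ a) * rough_lsum R Q m (Num.truncn (x `^ eta) %/ b).
Proof.
move=> Q1 e0 e1 x1 /andP[a0 aM] /andP[b0 bM] HX HY.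
have x0 : 0 < x by exact: lt_le_trans x1.
have r0 := tdens_gt0 R Q1.
have Qj j : 0 < Q%:R ^+ j :> R by rewrite exprn_gt0 // ltr0n ltnW.
have aR : 0 < a%:R :> R by rewrite ltr0n.
have bR : 0 < b%:R :> R by rewrite ltr0n.
have MR : 0 < M.+1%:R :> R by [].
have trunc_div (y : R) c : 0 <= y -> (0 < c)%N -> y / c%:R < (Num.truncn y %/ c).+1%:R.
  move=> y0 c0; rewrite ltr_pdivrMr ?ltr0n // -natrM.
  apply: lt_le_trans (truncnS_gt y) _; by rewrite ler_nat -ltn_divLR.
have le_a (y w : R) c : (0 < c < M)%N -> 0 <= w -> M.+1%:R * w <= y -> w <= y / c%:R.
  move=> /andP[c0 cM] w0 h; rewrite ler_pdivlMr ?ltr0n //; apply: le_trans h.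
  by rewrite mulrC ler_wpM2r // ler_nat ltnW // ltnW.
have Qa : Q%:R ^+ k.+1 <= eps * (x / a%:R).
  by rewrite mulrA; apply: le_a HX; rewrite ?a0 // ltW.
have Qb : Q%:R ^+ m <= x `^ eta / b%:R by apply: le_a HY; rewrite ?b0 // ltW.
have D := rough_dsum_ge Q1 e0 e1 Qa (trunc_div _ _ (ltW x0) a0).
have L := rough_lsum_ge Q1 Qb (trunc_div _ _ (powR_ge0 x eta) b0).
have MQ j : 0 < M.+1%:R * Q%:R ^+ j :> R by exact: mulr_gt0 MR (Qj j).
have eMQ : 0 < eps / (M.+1%:R * Q%:R ^+ k.+1) by exact: divr_gt0 e0 (MQ _).
have xa : 0 < eps * (x / a%:R) / Q%:R ^+ k.+1.
  exact: divr_gt0 (mulr_gt0 e0 (divr_gt0 x0 aR)) (Qj _).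
have xe : 0 < x `^ eta by apply: powR_gt0.
have xb : 0 < x `^ eta / b%:R / Q%:R ^+ m by exact: divr_gt0 (divr_gt0 xe bR) (Qj _).
have leV c j : (0 < c < M)%N -> (M.+1%:R * Q%:R ^+ j)^-1 <= (c%:R)^-1 / Q%:R ^+ j :> R.
  move=> /andP[c0 cM]; rewrite invfM; apply: ler_wpM2r; first by rewrite invr_ge0 (ltW (Qj j)).
  by rewrite lef_pV2 ?posrE ?ltr0n // ler_nat ltnW // ltnW.
have lnD : ln x + ln (eps / (M.+1%:R * Q%:R ^+ k.+1)) <= ln (eps * (x / a%:R) / Q%:R ^+ k.+1).
  rewrite -lnM ?posrE // ler_ln ?posrE //; last exact: mulr_gt0 x0 eMQ.
  rewrite mulrA [x * eps]mulrC -!mulrA; apply: ler_wpM2l; first exact: ltW.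
  by apply: ler_wpM2l; [exact: ltW | apply: leV; rewrite a0].
have lnD0 : 0 <= ln x + ln (eps / (M.+1%:R * Q%:R ^+ k.+1)).
  by rewrite -lnM ?posrE // ln_ge0 // mulrA [x * eps]mulrC ler_pdivlMr ?MQ // mul1r.
have lnL : eta * ln x + - ln (M.+1%:R * Q%:R ^+ m) <= ln (x `^ eta / b%:R / Q%:R ^+ m).
  rewrite -ln_powR -ln_div ?posrE ?MQ // ler_ln ?posrE //; last exact: divr_gt0 xe (MQ _).
  by rewrite -mulrA; apply: ler_wpM2l; [exact: ltW | apply: leV; rewrite b0].
have lnL0 : 0 <= eta * ln x + - ln (M.+1%:R * Q%:R ^+ m).
  by rewrite -ln_powR -ln_div ?posrE ?MQ // ln_ge0 // ler_pdivlMr ?MQ // mul1r.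
have e1' : 0 <= 1 - eps by rewrite subr_ge0.
have fk j : 0 < j`!%:R :> R by rewrite ltr0n fact_gt0.
set A := ln x + _ in lnD lnD0 *; set B := eta * _ + _ in lnL lnL0 *.
apply: (@le_trans _ _ (a%:R * ((1 - eps) * (x / a%:R) * (tdens R Q ^+ k.+1 / k`!%:R * A ^+ k))
   * (tdens R Q ^+ m / m`!%:R * B ^+ m))).
  rewrite le_eqVlt; apply/orP; left; apply/eqP; rewrite exprD.
  by field; rewrite !gt_eqF.
have r0' j : 0 <= tdens R Q ^+ j / j`!%:R by rewrite divr_ge0 // exprn_ge0 // ltW.
have xa0 : 0 <= x / a%:R by rewrite divr_ge0 // ltW.
have pk : 0 <= tdens R Q ^+ k.+1 / k`!%:R by rewrite divr_ge0 // exprn_ge0 // ltW.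
apply: ler_pM.
- exact: mulr_ge0 (ltW aR) (mulr_ge0 (mulr_ge0 e1' xa0) (mulr_ge0 pk (exprn_ge0 _ lnD0))).
- exact: mulr_ge0 (r0' m) (exprn_ge0 _ lnL0).
- apply: ler_wpM2l; first exact: ltW.
  apply: le_trans D; apply: ler_wpM2l; first by rewrite mulr_ge0.
  by apply: ler_wpM2l => //; rewrite lerXn2r // nnegrE // (le_trans lnD0).
apply: le_trans L; apply: ler_wpM2l => //.
by rewrite lerXn2r // nnegrE // (le_trans lnL0).
Qed.

Lemma main_term_ge Q h k m M (x eps eta : R) : (1 < Q)%N ->
  0 < eps -> eps <= 1 -> 1 <= x ->
  M.+1%:R * Q%:R ^+ k.+1 <= eps * x -> M.+1%:R * Q%:R ^+ m <= x `^ eta ->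
  (1 - eps) * (tdens R Q ^+ (k.+1 + m) * pair_sum Q h k.+1 m M) / (k`!%:R * m`!%:R) * x *
    (ln x + ln (eps / (M.+1%:R * Q%:R ^+ k.+1))) ^+ k *
    (eta * ln x + - ln (M.+1%:R * Q%:R ^+ m)) ^+ m <=
  \sum_(1 <= b < M | (\pi(Q)).-nat b) \sum_(1 <= a < M | (\pi(Q)).-nat a)
     pair_wt R h k.+1 m a b * (a%:R * rough_dsum R Q k.+1 (Num.truncn x %/ a) *
        rough_lsum R Q m (Num.truncn (x `^ eta) %/ b)).
Proof.
move=> Q1 e0 e1 x1 HX HY.
set A := (ln x + _) ^+ k; set B := (eta * _ + _) ^+ m.
have -> : (1 - eps) * (tdens R Q ^+ (k.+1 + m) * pair_sum Q h k.+1 m M) / (k`!%:R * m`!%:R) * x * A * B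
  = pair_sum Q h k.+1 m M * ((1 - eps) * tdens R Q ^+ (k.+1 + m) / (k`!%:R * m`!%:R) * x * A * B) by ring.
rewrite /pair_sum mulr_suml big_nat_cond [leRHS]big_nat_cond; apply: ler_sum => b /andP[bM _].
rewrite mulr_suml big_nat_cond [leRHS]big_nat_cond; apply: ler_sum => a /andP[aM _].
by apply: ler_wpM2l; [exact: pair_wt_ge0|exact: rough_product_ge].
Qed.

(** The three subtracted terms stem from common primes above [z], from the error in the distribution
    hypothesis, and from class members up to [h]. Only the first has the order of the main term. *)
Lemma shifted_sum_lower Q z h k m M (x eps eta delta K : R) :
  (1 < Q)%N -> (0 < h)%N -> (\pi(Q)).-nat h -> (0 < z)%N ->
  (forall p, prime p -> (p <= z)%N -> (p %| Q)%N) ->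
  0 < eps -> eps <= 1 -> 0 < eta -> eta <= 1 -> 0 <= K ->
  (forall (x : R) q, 1 <= x -> (0 < q)%N -> q%:R <= x `^ eta ->
    (\sum_(1 <= n < (Num.truncn x).+1 | gcdn n q == gcdn h q) divk k.+1 n)%N%:R - K * x `^ (1 - delta)
    <= (totient (q %/ gcdn h q))%:R * (class_sum k.+1 (Num.truncn x) q h)%:R) ->
  1 <= x ->
  M.+1%:R * Q%:R ^+ k.+1 <= eps * x -> M.+1%:R * Q%:R ^+ m <= x `^ eta ->
  (1 - eps) * (tdens R Q ^+ (k.+1 + m) * pair_sum Q h k.+1 m M) / (k`!%:R * m`!%:R) * x *
    (ln x + ln (eps / (M.+1%:R * Q%:R ^+ k.+1))) ^+ k *
    (eta * ln x + - ln (M.+1%:R * Q%:R ^+ m)) ^+ m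
  - k.+1%:R * m%:R * (h%:R / tdens R Q) / z%:R * (x * (1 + ln x) ^+ (k + m))
  - K * (h%:R / tdens R Q) * x `^ (1 - delta) * (1 + ln x) ^+ m
  - (\sum_(1 <= n < h.+1) divk k.+1 n)%N%:R * x `^ eta * (1 + ln x) ^+ m
  <= (\sum_(1 <= n < (Num.truncn x).+1) divk k.+1 (n + h) * divk m.+1 n)%N%:R.
Proof.
move=> Q1 h0 hQ z0 zQ e0 e1 eta0 eta1 K0 HK x1 HX HY.
have x0 : 0 < x by exact: lt_le_trans x1.
have r0 := tdens_gt0 R Q1.
set X := Num.truncn x; set Y := Num.truncn (x `^ eta).
have xeta : x `^ eta <= x by rewrite -[leRHS](powRr1 (ltW x0)) ler_powR.
have YX : (Y <= X)%N by exact: le_truncn.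
have X1 : (0 < X)%N by rewrite /X truncn_gt0.
have Xx : X%:R <= x by rewrite truncn_le (ltW x0).
have Yx : Y%:R <= x `^ eta by rewrite truncn_le powR_ge0.
have u0 : 0 <= ln x by exact: ln_ge0.
have HXu : harm R X <= 1 + ln x.
  apply: le_trans (harm_le_ln R X1) _; rewrite lerD2l ler_ln ?posrE ?ltr0n //.
have HYu : harm R Y <= 1 + ln x by apply: le_trans (harm_le R YX) HXu.
have c0 : 0 <= h%:R / tdens R Q by rewrite divr_ge0 // ltW.
apply: le_trans (shifted_sum_ge R k.+1 m h YX).
set Dh : R := (\sum_(1 <= n < h.+1) divk k.+1 n)%N%:R.
have E0 : 0 <= K * x `^ (1 - delta) by rewrite mulr_ge0 // powR_ge0.
apply: (@le_trans _ _ (\sum_(1 <= q < Y.+1) ((\sum_(1 <= n < X.+1)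
     (gcdn n q == gcdn h q)%:R * ((divk k.+1 n)%:R * ((divk m q)%:R * smooth_wt R Q h q)))
     - K * x `^ (1 - delta) * ((divk m q)%:R * smooth_wt R Q h q) - Dh * (divk m q)%:R))); last first.
  apply: ler_sum_nat => q /andP[q0]; rewrite ltnS => qY.
  rewrite mulrBr [_ * Dh]mulrC lerD2r.
  have -> : \sum_(1 <= n < X.+1) (gcdn n q == gcdn h q)%:R * ((divk k.+1 n)%:R * ((divk m q)%:R * smooth_wt R Q h q)) =
     (divk m q)%:R * (smooth_wt R Q h q * (\sum_(1 <= n < X.+1 | gcdn n q == gcdn h q) divk k.+1 n)%N%:R) :> R.
    rewrite natr_sum [in RHS]big_mkcond !mulr_sumr; apply: eq_bigr => n _.
    by case: (_ == _); rewrite ?mul1r ?mul0r ?mulr0 //; ring.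
  have -> (S : R) : (divk m q)%:R * (smooth_wt R Q h q * S) - K * x `^ (1 - delta) * ((divk m q)%:R * smooth_wt R Q h q)
     = (divk m q)%:R * (smooth_wt R Q h q * (S - K * x `^ (1 - delta))) by ring.
  apply: ler_wpM2l => //.
  have qx : q%:R <= x `^ eta by apply: le_trans Yx; rewrite ler_nat.
  have := HK x q x1 q0 qx; rewrite -/X; set S := _ - _ => HS.
  (* Replacing [1 / phi] by the smaller [smooth_wt] lowers the product only if [S] is positive;
     otherwise the left side is at most 0 and the class sum is nonnegative. *)
  have [S0|S0] := leP S 0.
    by apply: le_trans (ler0n _ _); rewrite mulr_ge0_le0 // smooth_wt_ge0.
  have t0 : 0 < (totient (q %/ gcdn h q)%N)%:R :> R by rewrite ltr0n totient_quot_gt0.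
  apply: le_trans (ler_wpM2r (ltW S0) (smooth_wt_le_totient R h0 hQ q0)) _ => //.
  by rewrite mulrC ler_pdivrMr // mulrC.
rewrite !sumrB -mulr_sumr -mulr_sumr.
have G := gcd_sum_ge R Q1 h0 hQ k m M X Y z0 zQ.
have Mn := main_term_ge h Q1 e0 e1 x1 HX HY.
have w1 : 0 <= 1 + ln x by rewrite addr_ge0.
have lsumY : lsum R m Y <= (1 + ln x) ^+ m.
  by apply: le_trans (lsum_le R m Y) _; rewrite lerXn2r // nnegrE ?harm_ge0.
have s1 : \sum_(1 <= q < Y.+1) (divk m q)%:R * smooth_wt R Q h q <= h%:R / tdens R Q * (1 + ln x) ^+ m.
  apply: le_trans (ler_wpM2l c0 lsumY); rewrite mulr_sumr; apply: ler_sum_nat => q /andP[q0 _].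
  by rewrite mulrCA; apply: ler_wpM2l => //; exact: smooth_wt_le.
have s2 : \sum_(1 <= q < Y.+1) (divk m q)%:R <= x `^ eta * (1 + ln x) ^+ m :> R.
  apply: le_trans (ler_wpM2l (powR_ge0 _ _) lsumY); rewrite mulr_sumr.
  apply: ler_sum_nat => q /andP[q0]; rewrite ltnS => qY.
  rewrite mulrCA -[leLHS]mulr1; apply: ler_wpM2l => //.
  by rewrite ler_pdivlMr ?ltr0n // mul1r; apply: le_trans Yx; rewrite ler_nat.
apply: lerB; last by rewrite -mulrA; apply: ler_wpM2l.
apply: lerB; last first.
  rewrite [leRHS](_ : _ = K * x `^ (1 - delta) * (h%:R / tdens R Q * (1 + ln x) ^+ m)); last by ring.
  exact: ler_wpM2l.
apply: le_trans G; apply: lerB => //.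
apply: ler_wpM2l; first by rewrite !mulr_ge0 ?invr_ge0 // ltW.
rewrite exprD mulrA; apply: ler_pM; rewrite ?mulr_ge0 ?exprn_ge0 ?harm_ge0 //.
  by apply: ler_pM; rewrite ?exprn_ge0 ?harm_ge0 // lerXn2r // nnegrE ?harm_ge0.
by rewrite lerXn2r // nnegrE ?harm_ge0.
Qed.

End LowerBound.

(** * Passage to the limit in [x] *)

Section Final.
Variable R : realType.
Implicit Types (k m q h z M X Y : nat).

Lemma powRN_le (x d : R) : 1 < x -> 0 < d -> x `^ (- d) <= (ln x)^-1 / d.
Proof.
move=> x1 d0; have x0 : 0 < x by apply: lt_trans x1.
have u0 : 0 < ln x by rewrite ln_gt0.
rewrite powRN -invfM lef_pV2 ?posrE ?powR_gt0 ?mulr_gt0 //.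
rewrite /powR gt_eqF // mulrC; apply: le_trans (expR_ge1Dx _).
by rewrite lerDr.
Qed.

(** After division by [x * ln x ^ (k + m)], the lower bound is at least a polynomial [f] in
    [v = 1 / ln x]. The limit in [x] thus reduces to continuity of [f] at 0, where its value exceeds
    [c]. *)
Lemma shifted_ratio_lower Q z h k m M (eps eta delta K c : R) :
  (1 < Q)%N -> (0 < h)%N -> (\pi(Q)).-nat h -> (0 < z)%N ->
  (forall p, prime p -> (p <= z)%N -> (p %| Q)%N) ->
  0 < eps -> eps <= 1 -> 0 < eta -> eta < 1 -> 0 <= K -> 0 < delta ->
  (forall (x : R) q, 1 <= x -> (0 < q)%N -> q%:R <= x `^ eta ->
    (\sum_(1 <= n < (Num.truncn x).+1 | gcdn n q == gcdn h q) divk k.+1 n)%N%:R - K * x `^ (1 - delta)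
    <= (totient (q %/ gcdn h q))%:R * (class_sum k.+1 (Num.truncn x) q h)%:R) ->
  c < (1 - eps) * (tdens R Q ^+ (k.+1 + m) * pair_sum R Q h k.+1 m M) / (k`!%:R * m`!%:R) * eta ^+ m
      - k.+1%:R * m%:R * (h%:R / tdens R Q) / z%:R ->
  exists A : R, forall x, A < x ->
    c <= (\sum_(1 <= n < (Num.truncn x).+1) divk k.+1 (n + h) * divk m.+1 n)%N%:R / (x * ln x ^+ (k + m)).
Proof.
move=> Q1 h0 hQ z0 zQ e0 e1 eta0 eta1 K0 d0 HK.
set W := (1 - eps) * _ / _; set C3 := _ / z%:R => cW.
pose c1 : R := ln (eps / (M.+1%:R * Q%:R ^+ k.+1)); pose c2 : R := - ln (M.+1%:R * Q%:R ^+ m).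
pose Dh : R := (\sum_(1 <= n < h.+1) divk k.+1 n)%N%:R.
pose Kh : R := K * (h%:R / tdens R Q).
have r0 := tdens_gt0 R Q1.
have Kh0 : 0 <= Kh by rewrite mulr_ge0 // divr_ge0 // ltW.
have Dh0 : 0 <= Dh by rewrite /Dh.
(* By [powRN_le] each power saving is worth one factor [v], at the cost of [1 / delta] or
   [1 / (1 - eta)]; this is where [eta < 1] enters. The [2 ^ m] comes from [1 + u <= 2 u]. *)
pose C6 := (Kh / delta + Dh / (1 - eta)) * 2 ^+ m.
pose f (v : R) := W * (1 + c1 * v) ^+ k * (eta + c2 * v) ^+ m - C3 * (1 + v) ^+ (k + m) - C6 * v.
have idc : id @ (0 : R) --> (0 : R) by exact: cvg_id.
have fcv : f @ (0 : R) --> W * eta ^+ m - C3.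
  have -> : W * eta ^+ m - C3 = W * (1 + c1 * 0) ^+ k * (eta + c2 * 0) ^+ m - C3 * (1 + 0) ^+ (k + m) - C6 * 0.
    by rewrite !mulr0 !addr0 !expr1n subr0 !mulr1.
  apply: cvgB; last by apply: cvgMl_tmp.
  apply: cvgB; last first.
    apply: cvgMl_tmp; apply: cvg_exprn; apply: cvgD => //; exact: cvg_cst.
  apply: cvgM.
    apply: cvgMl_tmp; apply: cvg_exprn; apply: cvgD; first exact: cvg_cst.
    exact: cvgMl_tmp.
  apply: cvg_exprn; apply: cvgD; first exact: cvg_cst.
  exact: cvgMl_tmp.
have [d dpos Hd] : exists2 d : R, 0 < d & forall v, `|v| < d -> c <= f v.
  have s0 : 0 < W * eta ^+ m - C3 - c by rewrite subr_gt0.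
  have /cvgrPdist_le/(_ _ s0) /nbhs_ballP[d /= dpos Hd] := fcv.
  exists d => // v vd; have := Hd v; rewrite /ball /= sub0r normrN => /(_ vd).
  by rewrite ler_distl => /andP[]; lra.
pose MX : R := M.+1%:R * Q%:R ^+ k.+1; pose MY : R := M.+1%:R * Q%:R ^+ m.
have Qj j : 0 < Q%:R ^+ j :> R by rewrite exprn_gt0 // ltr0n ltnW.
have MX0 : 0 < MX by exact: mulr_gt0.
have MY0 : 0 < MY by exact: mulr_gt0.
(* One summand per requirement on [u = ln x]: [u > 1], [1 / u < d], and the two size conditions
   involving [M], which follow from [u <= x] and [eta * u <= x ^ eta]. *)
pose U := 1 + d^-1 + MX / eps + MY / eta.
have p1 : 0 < d^-1 by rewrite invr_gt0.
have p2 : 0 < MX / eps by rewrite divr_gt0.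
have p3 : 0 < MY / eta by rewrite divr_gt0.
exists (expR U) => x Ux.
have x0 : 0 < x by apply: lt_trans Ux; exact: expR_gt0.
set u := ln x.
have uU : U < u by rewrite -[U]expRK ltr_ln ?posrE ?expR_gt0.
have u1 : 1 < u by move: uU; rewrite /U; lra.
have u0 : 0 < u by exact: lt_trans u1.
have x1 : 1 < x by rewrite -ltr_ln ?posrE // ln1.
have xE : x = expR u by rewrite lnK.
have uX : MX / eps <= u by move: uU; rewrite /U; lra.
have uY : MY / eta <= u by move: uU; rewrite /U; lra.
have ux : u <= x by rewrite [leRHS]xE; apply: le_trans (expR_ge1Dx _); rewrite lerDr.
have HX : M.+1%:R * Q%:R ^+ k.+1 <= eps * x.
  have h1 : MX <= u * eps by rewrite -ler_pdivrMr.
  by apply: le_trans h1 _; rewrite mulrC; apply: ler_wpM2l => //; exact: ltW.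
have HY : M.+1%:R * Q%:R ^+ m <= x `^ eta.
  rewrite /powR gt_eqF // -/u; apply: le_trans (expR_ge1Dx _).
  have : MY <= u * eta by rewrite -ler_pdivrMr.
  rewrite mulrC => h1; apply: le_trans h1 _; by rewrite lerDr.
have den0 : 0 < x * u ^+ (k + m) by rewrite mulr_gt0 // exprn_gt0.
have := shifted_sum_lower Q1 h0 hQ z0 zQ e0 e1 eta0 (ltW eta1) K0 HK (ltW x1) HX HY.
rewrite -/W -/C3 -/c1 -/c2 -/Dh -/u -/Kh => low.
rewrite ler_pdivlMr //; apply: le_trans low.
pose v := u^-1.
have v0 : 0 < v by rewrite invr_gt0.
have uv : u * v = 1 by rewrite divff // gt_eqF.
have vd : `|v| < d.
  rewrite gtr0_norm // /v invf_plt ?posrE //; move: uU; rewrite /U; lra.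
have := Hd v vd => /(ler_wpM2r (ltW den0)) => /le_trans; apply.
have pw : (1 + u) ^+ m <= 2 ^+ m * u ^+ (k + m).
  apply: (@le_trans _ _ ((2 * u) ^+ m)).
    by rewrite lerXn2r // ?nnegrE; lra.
  rewrite exprMn exprD; apply: ler_wpM2l; first by rewrite exprn_ge0.
  by rewrite ler_peMl ?exprn_ge0 ?exprn_ege1 // ltW.
have xd : x `^ (1 - delta) <= x * (v / delta).
  rewrite powRD; last by rewrite (gt_eqF x0) implybT.
  by rewrite powRr1 ?(ltW x0) // ler_wpM2l ?(ltW x0) // powRN_le.
have xe : x `^ eta <= x * (v / (1 - eta)).
  have -> : x `^ eta = x `^ (1 + - (1 - eta)) by congr (_ `^ _); ring.
  rewrite powRD; last by rewrite (gt_eqF x0) implybT.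
  rewrite powRr1 ?(ltW x0) // ler_wpM2l ?(ltW x0) //.
  by apply: powRN_le => //; rewrite subr_gt0.
have E1 : W * x * (u + c1) ^+ k * (eta * u + c2) ^+ m =
    W * (1 + c1 * v) ^+ k * (eta + c2 * v) ^+ m * (x * u ^+ (k + m)).
  have -> : u + c1 = (1 + c1 * v) * u by rewrite mulrDl mul1r -mulrA [v * u]mulrC uv mulr1.
  have -> : eta * u + c2 = (eta + c2 * v) * u by rewrite mulrDl -mulrA [v * u]mulrC uv mulr1.
  by rewrite !exprMn exprD; ring.
have E2 : C3 * (x * (1 + u) ^+ (k + m)) = C3 * (1 + v) ^+ (k + m) * (x * u ^+ (k + m)).
  have -> : 1 + u = (1 + v) * u by rewrite mulrDl mul1r [v * u]mulrC uv addrC.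
  by rewrite !exprMn; ring.
have w0 : 0 <= (1 + u) ^+ m by apply: exprn_ge0; lra.
have B1 : Kh * x `^ (1 - delta) * (1 + u) ^+ m <= Kh / delta * 2 ^+ m * v * (x * u ^+ (k + m)).
  have -> : Kh / delta * 2 ^+ m * v * (x * u ^+ (k + m)) = Kh * (x * (v / delta)) * (2 ^+ m * u ^+ (k + m)) by ring.
  by apply: ler_pM; [rewrite mulr_ge0 ?powR_ge0|exact: w0|exact: ler_wpM2l|exact: pw].
have B2 : Dh * x `^ eta * (1 + u) ^+ m <= Dh / (1 - eta) * 2 ^+ m * v * (x * u ^+ (k + m)).
  have -> : Dh / (1 - eta) * 2 ^+ m * v * (x * u ^+ (k + m)) = Dh * (x * (v / (1 - eta))) * (2 ^+ m * u ^+ (k + m)) by ring.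
  by apply: ler_pM; [rewrite mulr_ge0 ?powR_ge0|exact: w0|exact: ler_wpM2l|exact: pw].
rewrite E1 E2 /f /C6 !mulrBl -!addrA lerD2l lerD2l !mulrDl.
by rewrite opprD lerD // lerN2.
Qed.

End Final.

(** * Choice of the parameters *)

Section Choice.
Variable R : realType.

(** One [eps] serves both as the loss in the exponent of distribution and as the relative loss in
    [rough_dsum_ge], so continuity at 0 of a single function suffices. *)
Lemma choose_eps (m : nat) (theta L e : R) : 0 < theta -> 0 < e ->
  exists2 eps : R, 0 < eps < theta & theta ^+ m * L - e <= (1 - eps) * (theta - eps) ^+ m * L.
Proof.
move=> t0 e0; pose g (v : R) := (1 - v) * (theta - v) ^+ m * L.
have gcv : g @ (0 : R) --> theta ^+ m * L.
  have -> : theta ^+ m * L = (1 - 0) * (theta - 0) ^+ m * L by rewrite !subr0 mul1r.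
  apply: cvgM; last exact: cvg_cst.
  apply: cvgM; first by apply: cvgB; [exact: cvg_cst|exact: cvg_id].
  by apply: cvg_exprn; apply: cvgB; [exact: cvg_cst|exact: cvg_id].
have /cvgrPdist_le/(_ _ e0) /nbhs_ballP[d /= d0 Hd] := gcv.
exists (Num.min (theta / 2) (d / 2)).
  by rewrite lt_min gt_min; apply/andP; split; [apply/andP; split; lra | apply/orP; left; lra].
set v := Num.min _ _; have v0 : 0 < v by rewrite lt_min; apply/andP; split; lra.
have vd : v <= d / 2 by rewrite ge_min lexx orbT.
have := Hd v; rewrite /ball /= sub0r normrN gtr0_norm //.
by move=> /(_ ltac:(lra)); rewrite ler_distl /g => /andP[]; lra.
Qed.

(** For [z = 2 t + 1], [tdens_fact_sqr] bounds the quantity by [2 Z0 / sqrt z]. It is at most [e]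
    once [z >= 4 Z0^2 / e^2], which is [B]; comparing squares avoids the root. *)
Lemma coprimality_loss_small (Z0 e : R) (n0 : nat) : 0 <= Z0 -> 0 < e ->
  exists t, [/\ (0 < t)%N, (n0 <= t)%N & Z0 / tdens R (t.*2.+1)`! / t.*2.+1%:R <= e].
Proof.
move=> Z00 e0; pose B := 4 * Z0 ^+ 2 / e ^+ 2.
exists (maxn (Num.truncn B).+1 n0); set t := maxn _ _.
have tB : B <= t%:R.
  apply: le_trans (ltW (truncnS_gt B)) _; by rewrite ler_nat leq_maxl.
have t0 : (0 < t)%N by rewrite leq_max.
split => //; first exact: leq_maxr.
have tz : t%:R <= t.*2.+1%:R :> R by rewrite ler_nat; lia.
set z : R := t.*2.+1%:R in tz *; have z0 : 0 < z by rewrite ltr0n.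
have rsq := tdens_fact_sqr R t; rewrite -/z in rsq.
have r0 : 0 < tdens R (t.*2.+1)`! by rewrite divr_gt0 ?ltr0n ?totient_gt0 ?fact_gt0.
set r := tdens R _ in rsq r0 *.
have nn : 0 <= Z0 / r / z by rewrite !divr_ge0 ?(ltW r0) ?(ltW z0).
rewrite -(@ler_pXn2r _ 2) ?nnegrE ?nn ?(ltW e0) //.
have e2 : 0 < e ^+ 2 by rewrite exprn_gt0.
have zB : 4 * Z0 ^+ 2 <= z * e ^+ 2.
  by rewrite -ler_pdivrMr //; apply: le_trans tB tz.
rewrite -mulrA -invfM expr_div_n ler_pdivrMr; last exact: exprn_gt0 (mulr_gt0 r0 z0).
have rz : 1 <= r ^+ 2 * (4 * z).
  by rewrite -ler_pdivrMr ?mulr_gt0 // div1r.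
have H1 : z * e ^+ 2 * 1 <= z * e ^+ 2 * (r ^+ 2 * (4 * z)).
  by apply: ler_wpM2l => //; rewrite mulr_ge0 ?(ltW z0) ?(ltW e2).
have -> : e ^+ 2 * (r * z) ^+ 2 = (z * e ^+ 2 * (r ^+ 2 * (4 * z))) / 4 by field.
rewrite ler_pdivlMr //; lra.
Qed.

End Choice.

Theorem corollary1p5 (R : realType) (h k l : nat) (theta : R)
    (h_gt0 : (0 < h)%N) (k_gt0 : (0 < k)%N) (l_gt0 : (0 < l)%N)
    (theta_gt0 : 0 < theta) (theta_le1 : theta <= 1)
    (theta_exp : forall g : nat, (0 < g)%N ->
       exponent_of_distribution k g theta) :
  ((theta ^+ (l - 1) * (Ckl R k l * fkl R k l h)
      / ((k - 1)`!%:R * (l - 1)`!%:R))%:E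
   <= limf_einf
        (fun x : R =>
           ((\sum_(1 <= n < (Num.truncn x).+1) divk k (n + h) * divk l n)%N%:R
              / (x * ln x ^+ (k + l - 2)))%:E)
        (pinfty_nbhs R))%E.
Proof.
case: k k_gt0 theta_exp => // k _ theta_exp; case: l l_gt0 => // m _.
rewrite !subn1 (_ : k.+1 + m.+1 - 2 = k + m)%N; last by lia.
(* [limf_einf] is a supremum of infima over sets of the filter, so for each [e] a single half-line
   with ratio at least the target minus [e] is enough. *)
rewrite /= limf_einfE; apply/lee_subgt0Pr => e e0; apply: le_ereal_sup_tmp.
set L := Ckl _ _ _ * _; set F : R := k`!%:R * m`!%:R.
have F1 : 1 <= F by rewrite /F -natrM ler1n muln_gt0 !fact_gt0.
have F0 : 0 < F by apply: lt_le_trans F1.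
(* Three losses of at most [e / 4] occur: from [eps], from the primes above [z], and from the
   truncated Euler product. Their total stays strictly below [e], as [cW] demands. *)
have [eps /andP[eps0 epst] Heps] := choose_eps m L theta_gt0 (divr_gt0 e0 (ltr0n R 4)).
have Z0 : 0 <= k.+1%:R * m%:R * h%:R :> R by rewrite !mulr_ge0.
have [t [t0 ht HC3]] := coprimality_loss_small h Z0 (divr_gt0 e0 (ltr0n R 4)).
set z := t.*2.+1 in HC3; set Q := z`! in HC3.
have hz : (h <= z)%N by rewrite /z; lia.
have Q1 : (1 < Q)%N.
  by apply: (@leq_trans z); [rewrite /z; lia | exact: fact_geq].
have [M HM] := euler_limit k m h_gt0 hz (divr_gt0 e0 (ltr0n R 4)).
have eta0 : 0 < theta - eps by rewrite subr_gt0.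
have eta1 : theta - eps < 1 by lra.
have eps1 : eps <= 1 by lra.
have [delta [K [d0 K0 HK]]] := equidistribution h_gt0 eps0 theta_exp.
have hQ : (\pi(Q)).-nat h.
  apply/pnatP => // p pp ph; rewrite inE /= mem_primes pp fact_gt0 prime_dvd_fact //.
  by apply: leq_trans hz; rewrite dvdn_leq.
have zQ p : prime p -> (p <= z)%N -> (p %| Q)%N by move=> pp; rewrite prime_dvd_fact.
set V := _ * \sum_(1 <= b < M | _) _ in HM.
have cW : theta ^+ m * L / F - e <
    (1 - eps) * (tdens R Q ^+ (k.+1 + m) * pair_sum R Q h k.+1 m M) / F * (theta - eps) ^+ m
      - k.+1%:R * m%:R * (h%:R / tdens R Q) / z%:R.
  rewrite (_ : k.+1%:R * m%:R * (h%:R / tdens R Q) / z%:R =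
    k.+1%:R * m%:R * h%:R / tdens R Q / z%:R); last by ring.
  rewrite -[X in (1 - eps) * X]/V.
  (* [p] multiplies the Euler product, and [p <= 1] keeps the loss of that product within
     [e / 4]. *)
  pose p := (1 - eps) * (theta - eps) ^+ m / F.
  have q0 : 0 <= (1 - eps) * (theta - eps) ^+ m.
    by rewrite mulr_ge0 ?exprn_ge0 ?subr_ge0 // ltW.
  have p0 : 0 <= p by rewrite divr_ge0 // ltW.
  have p1 : p <= 1.
    rewrite ler_pdivrMr // mul1r; apply: le_trans F1.
    apply: (@le_trans _ _ (1 * 1)); last by rewrite mulr1.
    apply: ler_pM; rewrite ?exprn_ge0 ?subr_ge0 ?(ltW epst) //; first by lra.
    by rewrite exprn_ile1 ?subr_ge0 ?(ltW epst) // ltW.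
  have H1 : theta ^+ m * L / F - e / 4 <= p * L.
    rewrite (_ : p * L = (1 - eps) * (theta - eps) ^+ m * L / F); last by rewrite /p; ring.
    apply: le_trans (ler_wpM2r _ Heps); last by rewrite invr_ge0 ltW.
    rewrite mulrBl lerD2l lerN2 ler_pdivrMr //; nra.
  have H2 : p * (L - e / 4) <= p * V by apply: ler_wpM2l.
  have H3 : p * (e / 4) <= e / 4 by nra.
  rewrite (_ : (1 - eps) * V / F * (theta - eps) ^+ m = p * V); last by rewrite /p; ring.
  rewrite mulrBr in H2; lra.
have [A HA] := shifted_ratio_lower Q1 h_gt0 hQ (isT : (0 < z)%N) zQ
  eps0 eps1 eta0 eta1 K0 d0 HK cW.
exists (ereal_inf [set ((\sum_(1 <= n < (Num.truncn x).+1) divk k.+1 (n + h) * divk m.+1 n)%N%:R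
              / (x * ln x ^+ (k + m)))%:E | x in [set x | A < x]]).
  exists [set x | A < x] => //; exists A; split => //; exact: num_real.
by apply: le_ereal_inf_tmp => _ [x Ax <-]; rewrite -EFinB lee_fin; exact: HA.
Qed.
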